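(* Let $n\geq 2$ be an integer, $b:=-n+i$, and let $D\subset\{0,1,\ldots,n^2\}$. Suppose either that $D\subset\{0,1,\ldots,\lfloor n^2/2\rfloor\}$ and $|\delta-\delta'|\neq1$ for all $\delta,\delta'\in\Delta:=D-D$, or that $\Delta$ is sparse. Then the level sets of $\Psi_{n,D}$ and of $\Theta_{n,D}$ are dense in $F_{n,D}$; that is, for every $\lambda$ in the respective codomain, $\Psi_{n,D}^{-1}(\{\lambda\})$ and $\Theta_{n,D}^{-1}(\{\lambda\})$ are dense in $F_{n,D}$.
   Context: $C_{n,D}$ is the attractor of $\{z\mapsto b^{-1}(z+d): d\in D\}$, i.e. $C_{n,D}=\{\sum_{j\ge1}d_jb^{-j}: d_j\in D\}$. For $\alpha\in\mathbb{C}$, $C(\alpha):=C_{n,D}\cap(C_{n,D}+\alpha)$, and $F_{n,D}:=\{\alpha\in\mathbb{C}: C(\alpha)\neq\emptyset\}$. $\Psi_{n,D}:F_{n,D}\to[0,\dim_HC_{n,D}]$, $\Psi_{n,D}(\alpha)=\dim_HC(\alpha)$ (Hausdorff dimension), and $\Theta_{n,D}:F_{n,D}\to[0,\dim_PC_{n,D}]$, $\Theta_{n,D}(\alpha)=\dim_PC(\alpha)$ (packing dimension). $\Delta$ is called sparse if for all $\delta\neq\delta'$ in $\Delta$, $|\delta-\delta'|>2$ when $n\ge5$, and $|\delta-\delta'|>3$ when $n\in\{2,3,4\}$. *)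

(* Defs.v *)
From HB Require Import structures.
From mathcomp Require Import all_boot all_order all_algebra.
From mathcomp Require Import all_classical all_reals all_analysis.
From mathcomp Require Import complex.

Set Implicit Arguments.
Unset Strict Implicit.
Unset Printing Implicit Defensive.

Import Order.TTheory GRing.Theory Num.Theory.
Import numFieldNormedType.Exports.
Local Open Scope classical_set_scope.
Local Open Scope ring_scope.

Section Defs.
Variable R : realType.
Local Notation C := (complex R).

Definition cdist (z w : C) : R :=
  Num.sqrt ((complex.Re z - complex.Re w) ^+ 2 + (complex.Im z - complex.Im w) ^+ 2).

(* diameter (in [0, +oo]); the diameter of the empty set is 0 *)
Definition diam (U : set C) : \bar R :=
  ereal_sup ([set (cdist x y)%:E | x in U & y in U] `|` [set 0%E]).

Definition hausdorff_delta (s delta : R) (E : set C) : \bar R :=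
  ereal_inf [set (\sum_(i <oo) ((fine (diam (U i))) `^ s)%:E)%E |
     U in [set U : nat -> set C |
           E `<=` \bigcup_i U i /\ forall i, (diam (U i) <= delta%:E)%E]].

Definition hausdorff_measure (s : R) (E : set C) : \bar R :=
  ereal_sup [set hausdorff_delta s delta E | delta in [set d : R | 0 < d]].

Definition dimH (E : set C) : \bar R :=
  ereal_inf [set s%:E | s in [set s : R | 0 < s /\ hausdorff_measure s E = 0%E]].

Definition cball (c : C) (r : R) : set C := [set z | cdist c z <= r].

(* packing delta-premeasure: sup over countable disjoint collections of closed
   balls with centres in E and radii at most delta of sum (2 r_i)^s.
   (Entries of radius 0 are allowed as padding, to encode finite collections;
   they contribute 0 since s > 0.)  The sup of the empty family is 0. *)
Definition packing_delta (s delta : R) (E : set C) : \bar R :=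
  ereal_sup ([set (\sum_(i <oo) ((2 * cr.2 i) `^ s)%:E)%E |
     cr in [set cr : (nat -> C) * (nat -> R) |
        let c := cr.1 in let r := cr.2 in
        (forall i, E (c i) /\ 0 <= r i <= delta) /\
        (forall i j, i <> j -> 0 < r i -> 0 < r j ->
           cball (c i) (r i) `&` cball (c j) (r j) = set0)]] `|` [set 0%E]).

(* P^s_0 = lim_{delta -> 0} P^s_delta *)
Definition packing_pre (s : R) (E : set C) : \bar R :=
  ereal_inf [set packing_delta s delta E | delta in [set d : R | 0 < d]].

Definition packing_measure (s : R) (E : set C) : \bar R :=
  ereal_inf [set (\sum_(i <oo) packing_pre s (Ei i))%E |
     Ei in [set Ei : nat -> set C | E `<=` \bigcup_i Ei i]].

Definition dimP (E : set C) : \bar R :=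
  ereal_inf [set s%:E | s in [set s : R | 0 < s /\ packing_measure s E = 0%E]].

Definition base (n : nat) : C := Complex (- n%:R) 1.

Definition CnD (n : nat) (D : set nat) : set C :=
  [set z : C | exists d : nat -> nat, (forall j, D (d j)) /\
     let S := fun N : nat =>
       \sum_(1 <= j < N.+1) ((d j)%:R : C) * (base n) ^- j in
     ((fun N => (complex.Re (S N) : R)) @ \oo --> complex.Re z) /\
     ((fun N => (complex.Im (S N) : R)) @ \oo --> complex.Im z)].

Definition Calpha (n : nat) (D : set nat) (alpha : C) : set C :=
  CnD n D `&` [set z | CnD n D (z - alpha)].

Definition FnD (n : nat) (D : set nat) : set C :=
  [set alpha | Calpha n D alpha !=set0].

Definition dense_in (S A : set C) : Prop :=
  forall a, A a -> forall e : R, 0 < e -> exists2 x, S x & cdist a x < e.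

End Defs.

Definition diffset (D : set nat) : set int :=
  [set (x%:Z - y%:Z)%R | x in D & y in D].

Definition sparse (n : nat) (Delta : set int) : Prop :=
  forall d d', Delta d -> Delta d' -> d <> d' ->
    if (5 <= n)%N then (2 < `|d - d'|)%R else (3 < `|d - d'|)%R.

Arguments CnD R n D : clear implicits.
Arguments Calpha R n D alpha : clear implicits.
Arguments FnD R n D : clear implicits.

(* Main.v *)
Require Import Defs.
From HB Require Import structures.
From mathcomp Require Import all_boot all_order all_algebra.
From mathcomp Require Import all_classical all_reals all_analysis.
From mathcomp Require Import complex.
From mathcomp Require Import zify ring lra.
Import Order.TTheory GRing.Theory Num.Theory.
Import numFieldNormedType.Exports.
Import ComplexField.Normc.
Local Open Scope classical_set_scope.
Local Open Scope ring_scope.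

Set Implicit Arguments.
Unset Strict Implicit.
Unset Printing Implicit Defensive.

(** Write [b = -n + i] and [rho = |b|].  The hypothesis on the digits forces
    expansions with digits in [Delta] to be unique, with a quantitative gap: if
    [sum_j e_j b^-j] is very small for digits [e_j] in [Delta - Delta], then the
    Gaussian integers [s_(m+1) = b s_m + e_(m+1)], [s_0 = e_0], stay in a disc of
    radius about [rho + 1] (resp. [2 rho + 2]) for several steps, and since the
    imaginary part of [s_(m+1)] is [x_m - n y_m] this squeezes [|e_0|] below the
    gap of [Delta].  Hence, for [alpha = sum_j alpha_j b^-j], the set [C(alpha)]
    consists of the expansions whose [j]-th digit lies in the intersection of [D]
    and [D + alpha_j].  If the number [M_k] of its words of length [k] is
    comparable to [rho^(lambda k)], then both its dimensions equal [lambda].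
    Given a point of [F], keep the first [K] digits [alpha_j] and afterwards take
    either [0] (all of [D] survives) or [max D - min D] (one digit survives),
    choosing [0] exactly when [floor (theta j)] jumps, where
    [theta = lambda / dim C]; this makes [M_k] comparable to
    [|D|^(theta k) = rho^(lambda k)]. *)

(** * Words and covers of sequence spaces *)

Section Words.
Variable E : nat -> seq nat.

Definition admissible (x : nat -> nat) := forall j, x j \in E j.

Fixpoint words (k : nat) : seq (seq nat) :=
  if k is k'.+1 then [seq rcons u a | u <- words k', a <- E k'] else [:: [::]].

Lemma size_words k : size (words k) = (\prod_(j < k) size (E j))%N.
Proof.
elim: k => [|k IH]; first by rewrite big_ord0.
by rewrite big_ord_recr /= size_allpairs IH.
Qed.

Lemma mem_words x k : admissible x -> mkseq x k \in words k.
Proof.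
move=> xE; elim: k => [|k IH]; first by rewrite inE.
by rewrite mkseqS /=; apply/allpairsP; exists (mkseq x k, x k); split=> //; exact: xE.
Qed.

Lemma size_word u k : u \in words k -> size u = k.
Proof.
elim: k u => [|k IH] u; first by rewrite inE => /eqP ->.
by case/allpairsP => -[v a] /= [/IH <- _ ->]; rewrite size_rcons.
Qed.

Lemma uniq_words : (forall j, uniq (E j)) -> forall k, uniq (words k).
Proof.
move=> uE; elim=> [//|k IH]; apply: allpairs_uniq => //.
by move=> [u a] [v c] _ _ /= /rcons_inj [-> ->].
Qed.

(** Every word of length [k] has equally many extensions to length [K], so the proportion of words
    whose prefix satisfies [P] does not depend on [K]. The identity is cross-multiplied to stay in
    the natural numbers. *)
Lemma count_take (P : pred (seq nat)) k K : (k <= K)%N ->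
  (count (fun v => P (take k v)) (words K) * size (words k) =
   count P (words k) * size (words K))%N.
Proof.
elim: K => [|K IH]; first by rewrite leqn0 => /eqP ->.
rewrite leq_eqVlt => /predU1P[-> |kK].
  congr (_ * _)%N; apply: eq_in_count => v /size_word sv.
  by rewrite -sv take_size.
have {}IH := IH kK; rewrite /= size_allpairs mulnA -IH mulnAC; congr (_ * _)%N.
rewrite count_flatten -map_comp.
rewrite [sumn _](_ : _ = \sum_(v <- words K) P (take k v) * size (E K))%N; last first.
  rewrite sumnE big_map big_seq [RHS]big_seq; apply: eq_bigr => v /size_word sv /=.
  rewrite count_map -sum1_count /=.
  under eq_bigl => a do rewrite -cats1 takel_cat ?sv//.
  by case: (P _); rewrite sum1_count ?count_pred0 ?count_predT ?mul1n.
rewrite -big_distrl /=; congr (_ * _)%N; rewrite -sum1_count [RHS]big_mkcond.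
by apply: eq_bigr => v _; case: (P _).
Qed.

(** * Uniform measure and compactness of the sequence space *)

Section Cover.
Hypothesis E0 : forall j, (0 < size (E j))%N.

Lemma admissible_inhabited : exists x, admissible x.
Proof. by exists (fun j => nth 0%N (E j) 0) => j; rewrite mem_nth. Qed.

Lemma words_extend u k : u \in words k ->
  exists2 x, admissible x & mkseq x k = u.
Proof.
elim: k u => [|k IH] u.
  by rewrite inE => /eqP ->; have [x] := admissible_inhabited; exists x.
case/allpairsP => -[v a] /= [/IH[x xE xv] aE ->].
exists (fun j => if j == k then a else x j).
  by move=> j; case: eqP => [->|].
rewrite mkseqS eqxx; congr rcons; rewrite -xv.
apply/eq_in_map => j; rewrite mem_iota add0n => /andP[_ jk].
by rewrite ltn_eqF.
Qed.

Lemma size_words_gt0 k : (0 < size (words k))%N.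
Proof. by rewrite size_words prodn_gt0. Qed.

(** Each term is the mass of a union of cylinders under the uniform measure on sequences, and sets
    covering everything have total mass at least 1. All masses are computed at the common length
    [K]. *)
Lemma finite_cover_weight (R : realType) (k : nat -> nat)
    (P : nat -> pred (seq nat)) m :
  (forall x, admissible x -> exists2 i, (i < m)%N & P i (mkseq x (k i))) ->
  1 <= \sum_(i < m) (count (P i) (words (k i)))%:R /
                    (size (words (k i)))%:R :> R.
Proof.
move=> cov; pose K := (\max_(i < m) k i)%N.
have kK (i : 'I_m) : (k i <= K)%N by exact: leq_bigmax_cond.
have wt (i : 'I_m) : (count (P i) (words (k i)))%:R / (size (words (k i)))%:R =
    (count (fun v => P i (take (k i) v)) (words K))%:R / (size (words K))%:R :> R.
  apply/eqP; rewrite eqr_div ?pnatr_eq0 -?lt0n ?size_words_gt0//.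
  by rewrite -!natrM -count_take.
under eq_bigr do rewrite wt.
rewrite -mulr_suml -natr_sum ler_pdivlMr ?ltr0n ?size_words_gt0// mul1r ler_nat.
rewrite -[size _]count_predT -sum1_count big_mkcond /=.
rewrite (eq_bigr (fun i : 'I_m => \sum_(v <- words K) P i (take (k i) v))%N); last first.
  by move=> i _; rewrite -sum1_count big_mkcond; apply: eq_bigr => v _; case: (P i _).
rewrite exchange_big /= big_seq [leqRHS]big_seq; apply: leq_sum => v vK.
have [x xE xv] := words_extend vK.
have [i im Pi] := cov x xE.
rewrite (bigD1 (Ordinal im)) //= -xv -{1}(subnKC (kK (Ordinal im))).
by rewrite /mkseq iotaD map_cat take_size_cat ?size_map ?size_iota// Pi.
Qed.

(* Koenig's lemma: if no finite subfamily covers, some sequence has all its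
   prefixes extendable to sequences missing any given finite subfamily. *)
Lemma finite_subcover (k : nat -> nat) (P : nat -> pred (seq nat)) :
  (forall x, admissible x -> exists i, P i (mkseq x (k i))) ->
  exists m, forall x, admissible x ->
    exists2 i, (i < m)%N & P i (mkseq x (k i)).
Proof.
move=> cov; apply: contrapT => nofin.
(* A prefix is bad if, for every [m], it extends to an admissible sequence that escapes the first
   [m] families. *)
pose bad l (u : nat -> nat) := forall m, exists x,
  [/\ admissible x, forall j, (j < l)%N -> x j = u j &
      forall i, (i < m)%N -> ~~ P i (mkseq x (k i))].
pose upd (u : nat -> nat) l a j := if j == l then a else u j : nat.
have bad0 u : bad 0%N u.
  move=> m; apply: contrapT => h; apply: nofin; exists m => x xE.
  apply: contrapT => h'; apply: h; exists x; split=> // i im.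
  by apply/negP => Pi; apply: h'; exists i.
have badS l u : exists a, bad l u -> bad l.+1 (upd u l a).
  apply: contrapT => /forallNP h.
  have {}h a : bad l u /\ exists m, forall x, admissible x ->
      (forall j, (j < l.+1)%N -> x j = upd u l a j) ->
      exists2 i, (i < m)%N & P i (mkseq x (k i)).
    have /not_implyP[bu nb] := h a; split=> //.
    move/existsNP: nb => [m nb]; exists m => x xE xu.
    apply: contrapT => h'; apply: nb; exists x; split=> // i im.
    by apply/negP => Pi; apply: h'; exists i.
  have [m mP] := choice (fun a => (h a).2).
  (* If no letter kept the prefix bad, the largest of the finitely many bounds [m a] would
     contradict the badness of the prefix itself. *)
  have [x [xE xu xP]] := (h 0%N).1 (\max_(a <- E l) m a)%N.
  have [|i im Pi] := mP (x l) x xE.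
    by move=> j; rewrite ltnS leq_eqVlt /upd; case: eqP => [->//|_ /=]; exact: xu.
  suff : ~~ P i (mkseq x (k i)) by rewrite Pi.
  by apply: xP; apply: leq_trans im _; apply: leq_bigmax_seq.
have [g gP] := choice (fun lu : nat * (nat -> nat) => badS lu.1 lu.2).
(* Letters are chosen one at a time; the diagonal [z] agrees with [U l] below [l], so all its
   prefixes are bad. *)
pose U := fix U l := if l is l'.+1 then upd (U l') l' (g (l', U l')) else (fun=> 0%N).
have badU l : bad l (U l) by elim: l => [|l IH] //=; exact: (gP (l, U l)).
pose z j := U j.+1 j.
have Uz l j : (j < l)%N -> U l j = z j.
  elim: l => // l IH; rewrite ltnS leq_eqVlt => /predU1P[->//|jl].
  by rewrite -IH //= /upd ltn_eqF.
have badz l : bad l z.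
  by move=> m; have [x [xE xu xP]] := badU l m; exists x; split=> // j jl; rewrite xu ?Uz.
have zE : admissible z.
  by move=> j; have [x [xE xu _]] := badz j.+1 0%N; rewrite -xu.
have [i Pi] := cov z zE.
have [x [xE xu /(_ i (ltnSn i))]] := badz (k i) i.+1.
suff -> : mkseq x (k i) = mkseq z (k i) by rewrite Pi.
by apply/eq_in_map => j; rewrite mem_iota add0n => /andP[_ /xu].
Qed.

End Cover.
End Words.

(** * Gaussian integer orbits *)

Lemma sqr_lt_norm_le (a c : int) : 0 <= c -> a ^+ 2 < (c + 1) ^+ 2 -> `|a| <= c.
Proof.
move=> c0 ac; suff : `|a| < c + 1 by lia.
by rewrite -(ltr_pXn2r (n:=2)) ?nnegrE ?normr_ge0 ?real_normK ?num_real//; lia.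
Qed.

Lemma norm_mul_bound (n y A c : int) : 0 < n ->
  `|n * y| <= A -> A < n * (c + 1) -> `|y| <= c.
Proof.
move=> n0; rewrite normrM (gtr0_norm n0) => h1 h2.
by have := le_lt_trans h1 h2; rewrite ltr_pM2l//; lia.
Qed.

Section GaussOrbit.
Variables (n : int) (x y e : nat -> int).
Hypothesis n2 : 2 <= n.
Hypothesis xS : forall m, x m.+1 = - n * x m - y m + e m.+1.
Hypothesis yS : forall m, y m.+1 = x m - n * y m.
Hypothesis y0 : y 0%N = 0.

(** Since [n * y m = x m - y m.+1], a bound [A] on the [y m] improves to [(X + A) / n], rounded
    down, at the cost of one index. *)
Lemma orbit_im_step (X : int) M A c :
  (forall m, (m <= M.+1)%N -> `|x m| <= X) ->
  (forall m, (m <= M.+1)%N -> `|y m| <= A) ->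
  X + A < n * (c + 1) ->
  forall m, (m <= M)%N -> `|y m| <= c.
Proof.
move=> xB yB h m mM; apply: (norm_mul_bound (n := n) (A := X + A)) => //; first by lia.
have := yB m.+1 mM; have := xB m (leqW mM); rewrite yS; lia.
Qed.

(** The disc gives the bound [n + 1] on both coordinates. Two rounds of [orbit_im_step] bring it
    down to 1 for the [y m] when [n >= 4], and [y 1 = x 0]. For [n = 2] and [n = 3] one round leaves
    a few values of [y 1] to exclude. *)
Lemma gauss_orbit_gap1 :
  (forall m, `|e m| <= n ^+ 2) ->
  (forall m, (m <= 6)%N -> x m ^+ 2 + y m ^+ 2 <= n ^+ 2 + 2 * n + 3) ->
  `|x 0%N| <= 1.
Proof.
move=> eB sB; have [X XE] : exists X, X = n + 1 by exists (n + 1).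
have xB m : (m <= 6)%N -> `|x m| <= X.
  by move=> /sB h; apply: sqr_lt_norm_le; rewrite XE; have := sqr_ge0 (y m); lia.
have yB m : (m <= 6)%N -> `|y m| <= X.
  by move=> /sB h; apply: sqr_lt_norm_le; rewrite XE; have := sqr_ge0 (x m); lia.
have y1 : y 1%N = x 0%N by rewrite yS y0; ring.
rewrite -y1.
have [n4|n3] := lerP 4 n.
  have yB2 := orbit_im_step (M:=5) (c:=2) xB yB.
  apply: (orbit_im_step (X:=X) (M:=4) (A:=2) (c:=1)) => // [m m5|m m5|]; last by lia.
    exact/xB/leqW.
  by apply: yB2 => //; lia.
have {n3} : n = 2 \/ n = 3 by lia.
case=> nE.
  have yB2 : forall m, (m <= 5)%N -> `|y m| <= 3.
    by apply: (orbit_im_step xB yB); lia.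
  have := yB2 2%N isT; have := yB2 1%N isT; rewrite (yS 1%N).
  have := sB 1%N isT. have := eB 1%N.
  have := xS 0%N; rewrite y0 -y1 => ->.
  rewrite nE.  move: (y 1%N) (e 1%N) => a c; move=> h1 h2 h3 h4.
  (* The exceptional values contradict the disc bound at index 1 combined with the bounds on [y 2]
     and [e 1]. *)
  have : [|| a == 3, a == 2, a == -3, a == -2 | `|a| <= 1] by lia.
  case/or4P => [/eqP|/eqP|/eqP|/orP[/eqP|]]; [move=> aE; subst a.. |by []]; try lia.
have yB2 : forall m, (m <= 5)%N -> `|y m| <= 2.
  by apply: (orbit_im_step xB yB); lia.
have := yB2 2%N isT; have := yB2 1%N isT; rewrite (yS 1%N).
have := sB 1%N isT; rewrite nE; move: (y 1%N) (x 1%N) => a c h1 h2 h3.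
have : [|| a == 2, a == -2 | `|a| <= 1] by lia.
by case/or3P => [/eqP aE|/eqP aE|//]; subst a; nia.
Qed.

(** The disc is twice as large, so the iteration starts from [2 * n + 2]. It reaches 2 when [n >= 6]
    and 3 when [n = 4]; for [n] equal to 5, 3, 2 it stalls at 3, 4, 6, and the remaining values of
    [y 1] are excluded through index 1 and [y 2]. *)
Lemma gauss_orbit_gap2 :
  (forall m, `|e m| <= 2 * n ^+ 2) ->
  (forall m, (m <= 6)%N -> x m ^+ 2 + y m ^+ 2 <= 4 * (n ^+ 2 + 2 * n + 3)) ->
  `|x 0%N| <= if 5 <= n then 2 else 3.
Proof.
move=> eB sB; have [X XE] : exists X, X = 2 * n + 2 by exists (2 * n + 2).
have xB m : (m <= 6)%N -> `|x m| <= X.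
  by move=> /sB h; apply: sqr_lt_norm_le; rewrite XE; have := sqr_ge0 (y m); lia.
have yB m : (m <= 6)%N -> `|y m| <= X.
  by move=> /sB h; apply: sqr_lt_norm_le; rewrite XE; have := sqr_ge0 (x m); lia.
have y1 : y 1%N = x 0%N by rewrite yS y0; ring.
have xB' k : (k <= 5)%N -> forall m, (m <= k.+1)%N -> `|x m| <= X.
  by move=> k5 m mk; apply: xB; lia.
rewrite -y1; case: ifP => n5.
  have yB4 : forall m, (m <= 5)%N -> `|y m| <= 4.
    by apply: (orbit_im_step xB yB); lia.
  have yB3 : forall m, (m <= 4)%N -> `|y m| <= 3.
    by apply: (orbit_im_step (xB' 4%N isT) yB4); lia.
  have [n6|n6] := lerP 6 n.
    by apply: (orbit_im_step (xB' 3%N isT) yB3) => //; lia.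
  have nE : n = 5 by lia.
  have := yB3 2%N isT; have := yB3 1%N isT; rewrite (yS 1%N).
  have := sB 1%N isT; rewrite nE; move: (y 1%N) (x 1%N) => a c h1 h2 h3.
  have : [|| a == 3, a == -3 | `|a| <= 2] by lia.
  by case/or3P => [/eqP aE|/eqP aE|//]; subst a; nia.
have : [|| n == 2, n == 3 | n == 4] by lia.
case/or3P => /eqP nE.
- have yB6 : forall m, (m <= 5)%N -> `|y m| <= 6.
    by apply: (orbit_im_step xB yB); lia.
  have := yB6 2%N isT; have := yB6 1%N isT; rewrite (yS 1%N).
  have := sB 1%N isT; have := eB 1%N; have := xS 0%N; rewrite y0 -y1 => ->.
  rewrite nE; move: (y 1%N) (e 1%N) => a c h1 h2 h3 h4.
  have : [|| 6 == `|a|, 5 == `|a|, 4 == `|a| | `|a| <= 3] by lia.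
  have [a0|a0] := lerP 0 a; [rewrite ger0_norm//|rewrite ltr0_norm//].
    by case/or4P => [/eqP aE|/eqP aE|/eqP aE|//]; subst a; nia.
  case/or4P => [/eqP aE|/eqP aE|/eqP aE|//].
  + have {}aE : a = -6 by lia. subst a; nia.
  + have {}aE : a = -5 by lia. subst a; nia.
  + have {}aE : a = -4 by lia. subst a; nia.
- have yB5 : forall m, (m <= 5)%N -> `|y m| <= 5.
    by apply: (orbit_im_step xB yB); lia.
  have yB4 : forall m, (m <= 4)%N -> `|y m| <= 4.
    by apply: (orbit_im_step (xB' 4%N isT) yB5); lia.
  have := yB4 2%N isT; have := yB4 1%N isT; rewrite (yS 1%N).
  have := sB 1%N isT; rewrite nE; move: (y 1%N) (x 1%N) => a c h1 h2 h3.
  have : [|| a == 4, a == -4 | `|a| <= 3] by lia.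
  by case/or3P => [/eqP aE|/eqP aE|//]; subst a; nia.
- have yB5 : forall m, (m <= 5)%N -> `|y m| <= 5.
    by apply: (orbit_im_step xB yB); lia.
  by apply: (orbit_im_step (xB' 4%N isT) yB5); lia.
Qed.

End GaussOrbit.

(** * Real series and powers *)

Section RealFacts.
Variable R : realType.

Lemma nneseries_EFin_le (u : nat -> R) (B : R) : (forall i, 0 <= u i) ->
  (forall m, \sum_(i < m) u i <= B) -> (\sum_(i <oo) (u i)%:E <= B%:E)%E.
Proof.
move=> u0 uB; apply: lime_le.
  by apply: is_cvg_nneseries => i _ _; rewrite lee_fin.
by apply: nearW => m; rewrite sumEFin lee_fin big_mkord.
Qed.

Lemma nneseries_EFin_ge (u : nat -> R) m : (forall i, 0 <= u i) ->
  ((\sum_(i < m) u i)%:E <= \sum_(i <oo) (u i)%:E)%E.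
Proof.
move=> u0; rewrite -(big_mkord xpredT) -sumEFin.
by apply: nneseries_lim_ge => i _ _; rewrite lee_fin.
Qed.

Lemma expN_small (r K e : R) : 1 < r -> 0 < e -> exists N, K * r ^- N < e.
Proof.
move=> r1 e0; have r0 : 0 < r by lra.
have rho1 : `|r^-1| < 1 by rewrite gtr0_norm ?invr_gt0// invf_lt1.
have /cvgrPdist_lt/(_ _ e0)[N _ /(_ N (leqnn _))] := cvg_geometric K rho1.
rewrite /= sub0r normrN exprVn => h; exists N.
exact: le_lt_trans (ler_norm _) h.
Qed.

(** Taking the least such [k] makes [e] comparable to [a * r ^- k], except that [k = 0] gives no
    upper bound on [e]. *)
Lemma scale_level (r a e : R) : 1 < r -> 0 < e ->
  exists k, a * r ^- k <= e /\ forall j, (j < k)%N -> e < a * r ^- j.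
Proof.
move=> r1 e0; have ex : exists N, a * r ^- N <= e.
  by have [N /ltW] := expN_small a r1 e0; exists N.
exists (ex_minn ex); case: ex_minnP => k ke kmin; split=> // j jk.
by rewrite ltNge; apply: contraTN jk => /kmin; rewrite -leqNgt.
Qed.

Lemma powR_scale (a r s : R) k : 0 <= a -> 0 < r ->
  (a * r ^- k) `^ s = a `^ s * (r `^ s) ^- k.
Proof.
move=> a0 r0; rewrite powRM// ?invr_ge0 ?exprn_ge0 ?ltW//; congr (_ * _).
by rewrite -powR_invn ?ltW// powRAC powR_invn// powR_ge0.
Qed.

Lemma geometric_partial_le (t : R) K : 0 <= t < 1 -> \sum_(l < K) t ^+ l <= (1 - t)^-1.
Proof.
move=> /andP[t0 t1]; have d0 : 0 < 1 - t by lra.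
rewrite -(ler_pM2l d0) divff ?gt_eqF//.
have : 0 <= t ^+ K by rewrite exprn_ge0.
have := subrX1 t K; rewrite -[X in X * _](opprB 1 t) mulNr; lra.
Qed.

Lemma sum_ord_lt_le m K (a : R) : 0 <= a ->
  \sum_(i < m) (if (i < K)%N then a else 0) <= K%:R * a.
Proof.
move=> a0; suff -> : \sum_(i < m) (if (i < K)%N then a else 0) = (minn m K)%:R * a.
  by rewrite ler_wpM2r// ler_nat geq_minr.
elim: m => [|m IH]; first by rewrite big_ord0 min0n mul0r.
rewrite big_ord_recr /= IH; have [mK|mK] := ltnP m K.
  by rewrite (minn_idPl mK) mulrSr mulrDl mul1r.
by rewrite (minn_idPr (leqW mK)) addr0.
Qed.

Lemma half_series_le m : \sum_(i < m) 2 ^- i.+1 <= 1 :> R.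
Proof.
suff : \sum_(i < m) 2 ^- i.+1 = 1 - 2 ^- m :> R.
  by move=> ->; rewrite gerBl invr_ge0 exprn_ge0.
elim: m => [|m IH]; first by rewrite big_ord0 expr0 invr1 subrr.
by rewrite big_ord_recr /= IH exprS invfM; lra.
Qed.

End RealFacts.

(** * Complex series in base [-n + i] *)

Section NormC.
Variable R : realType.
Implicit Types z w : complex R.

Lemma cdistE z w : cdist z w = normc (z - w).
Proof. by case: z => a b; case: w. Qed.

Lemma normc_ge0 z : 0 <= normc z.
Proof. by case: z => a b; exact: sqrtr_ge0. Qed.

Lemma normcD z w : normc (z + w) <= normc z + normc w.
Proof. exact: le_normcD. Qed.

Lemma normcX z k : normc (z ^+ k) = normc z ^+ k.
Proof. by elim: k => [|k IH]; rewrite ?expr0 ?normc1// !exprS normcM IH. Qed.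

Lemma normcB z w : normc (z - w) = normc (w - z).
Proof. by rewrite -normcN opprB. Qed.

Lemma normc_sqr z : normc z ^+ 2 = complex.Re z ^+ 2 + complex.Im z ^+ 2.
Proof. by case: z => a b; rewrite sqr_sqrtr// addr_ge0// sqr_ge0. Qed.

Lemma ReB z w : complex.Re (z - w) = complex.Re z - complex.Re w.
Proof. by case: z => a b; case: w. Qed.

Lemma ImB z w : complex.Im (z - w) = complex.Im z - complex.Im w.
Proof. by case: z => a b; case: w. Qed.

Lemma norm_Re_le z : `|complex.Re z| <= normc z.
Proof.
rewrite -(ler_pXn2r (n:=2)) ?nnegrE ?normc_ge0// real_normK ?num_real// normc_sqr.
by rewrite lerDl sqr_ge0.
Qed.

Lemma norm_Im_le z : `|complex.Im z| <= normc z.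
Proof.
rewrite -(ler_pXn2r (n:=2)) ?nnegrE ?normc_ge0// real_normK ?num_real// normc_sqr.
by rewrite lerDr sqr_ge0.
Qed.

Lemma normc_int (i : int) : normc (i%:~R : complex R) = `|i%:~R|.
Proof.
have -> : (i%:~R : complex R) = (i%:~R)%:C%C by rewrite rmorph_int.
by rewrite /= expr0n addr0 sqrtr_sqr.
Qed.

Lemma cdistC z w : cdist z w = cdist w z.
Proof. by rewrite !cdistE normcB. Qed.

Lemma cdist_triangle u z w : cdist z w <= cdist z u + cdist u w.
Proof. by rewrite !cdistE -[z - w](subrKA u); exact: normcD. Qed.

Lemma cdistzz z : cdist z z = 0.
Proof. by rewrite cdistE subrr normc0. Qed.

(** Componentwise, which is the form of convergence used in [CnD]. *)
Definition ccvg (S : nat -> complex R) z :=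
  ((fun N => complex.Re (S N)) @ \oo --> complex.Re z) /\
  ((fun N => complex.Im (S N)) @ \oo --> complex.Im z).

Lemma ccvg_unique S z w : ccvg S z -> ccvg S w -> z = w.
Proof.
move=> [zr zi] [wr wi]; case: z w zr zi wr wi => [a b] [c d] /= zr zi wr wi.
by congr Complex; [exact: (cvg_unique _ zr wr)|exact: (cvg_unique _ zi wi)].
Qed.

Lemma ccvgB S S' z w : ccvg S z -> ccvg S' w -> ccvg (fun N => S N - S' N) (z - w).
Proof.
move=> [zr zi] [wr wi]; split.
  by rewrite ReB; under eq_fun do rewrite ReB; exact: cvgB.
by rewrite ImB; under eq_fun do rewrite ImB; exact: cvgB.
Qed.

Lemma ccvg_normc_le S z a B N0 : ccvg S z ->
  (forall N, (N0 <= N)%N -> normc (S N - a) <= B) -> normc (z - a) <= B.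
Proof.
move=> [zr zi] SB; have B0 : 0 <= B := le_trans (normc_ge0 _) (SB N0 (leqnn _)).
rewrite -(ler_pXn2r (n:=2)) ?nnegrE ?normc_ge0// normc_sqr ReB ImB.
have cv : ((complex.Re (S N) - complex.Re a) ^+ 2 +
      (complex.Im (S N) - complex.Im a) ^+ 2) @[N --> \oo] -->
    (complex.Re z - complex.Re a) ^+ 2 + (complex.Im z - complex.Im a) ^+ 2.
  by apply: cvgD; rewrite !expr2; under eq_fun do rewrite expr2;
     apply: cvgM; apply: cvgB => //; exact: cvg_cst.
apply: (ler_cvg_to cv (cvg_cst (B ^+ 2))).
exists N0 => // N /= /SB h.
by rewrite -ReB -ImB -normc_sqr ler_pXn2r ?nnegrE ?normc_ge0.
Qed.

End NormC.

(** * Series in powers of the base, and the digit gap *)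

Section Series.
Variables (R : realType) (n : nat).
Hypothesis n2 : (2 <= n)%N.
Local Notation b := (base R n).

Definition rho : R := Num.sqrt (n%:R ^+ 2 + 1).

Lemma rho_sqr : rho ^+ 2 = n%:R ^+ 2 + 1.
Proof. by rewrite sqr_sqrtr// addr_ge0// sqr_ge0. Qed.

Lemma rho_ge2 : 2 <= rho.
Proof.
rewrite -(ler_pXn2r (n:=2)) ?nnegrE ?sqrtr_ge0// rho_sqr.
have : 2%:R <= n%:R :> R by rewrite ler_nat.
nra.
Qed.

Lemma rho_gt0 : 0 < rho. Proof. by have := rho_ge2; lra. Qed.
Lemma rho_gt1 : 1 < rho. Proof. by have := rho_ge2; lra. Qed.

Lemma rho_lt : rho < n%:R + 2^-1.
Proof.
rewrite -(ltr_pXn2r (n:=2)) ?nnegrE ?sqrtr_ge0 ?addr_ge0 ?invr_ge0// rho_sqr.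
have : 2%:R <= n%:R :> R by rewrite ler_nat.
nra.
Qed.

Lemma normc_base : normc b = rho.
Proof. by rewrite /= /rho sqrrN expr1n. Qed.

Lemma base_neq0 : b != 0.
Proof.
by apply/eqP => b0; have := rho_gt0; rewrite -normc_base b0 normc0 ltxx.
Qed.

(* Digits are indexed from 0 here: [e j] has weight [b^-(j+1)]. *)
Definition psum (e : nat -> int) (N : nat) : complex R :=
  \sum_(j < N) (e j)%:~R * b ^- j.+1.

Lemma psumB e e' N :
  psum (fun j => e j - e' j) N = psum e N - psum e' N.
Proof. by rewrite -sumrB; apply: eq_bigr => j _; rewrite intrB mulrBl. Qed.

Lemma psum_dist (B : int) e N M : (forall j, `|e j| <= B) -> (N <= M)%N ->
  normc (psum e M - psum e N) <= B%:~R / (rho - 1) * rho ^- N.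
Proof.
move=> eB; have B0 : 0 <= B := le_trans (normr_ge0 _) (eB 0%N).
have r1 : 0 < rho - 1 by have := rho_gt1; lra.
(* Sharpened for the induction: passing from [d] to [d.+1] raises this bound by exactly
   [B * rho ^- (N + d).+1], which bounds the new term. *)
suff h d : normc (psum e (N + d)%N - psum e N) <=
    B%:~R / (rho - 1) * (rho ^- N - rho ^- (N + d)).
  move=> /subnKC <-; apply: le_trans (h _) _; rewrite ler_wpM2l//.
    by rewrite divr_ge0 ?ler0z// ltW.
  by rewrite gerBl invr_ge0 exprn_ge0// ltW// rho_gt0.
elim: d => [|d IH]; first by rewrite addn0 !subrr normc0 mulr0.
rewrite addnS /psum big_ord_recr /= -/(psum _ _) addrAC.
apply: le_trans (normcD _ _) _; rewrite normcM normc_int normcV normcX normc_base.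
have h : `|(e (N + d)%N)%:~R| <= B%:~R :> R by rewrite -intr_norm ler_int.
have r0 := rho_gt0.
have h' : `|(e (N + d)%N)%:~R| / rho ^+ (N + d).+1 <= B%:~R / rho ^+ (N + d).+1 :> R.
  by rewrite ler_pM2r// invr_gt0 exprn_gt0.
apply: le_trans (lerD IH h') _.
rewrite le_eqVlt; apply/orP; left; apply/eqP.
have r10 : rho - 1 != 0 by rewrite gt_eqF.
have r00 : rho != 0 by rewrite gt_eqF.
rewrite exprS; have p0 : rho ^+ (N + d) != 0 by rewrite expf_neq0.
move: (rho ^- N) => t; field.
by rewrite r10 p0 r00.
Qed.

Lemma psum_ccvg (B : int) e : (forall j, `|e j| <= B) ->
  exists z, ccvg (psum e) z.
Proof.
move=> eB.
have cau (f : complex R -> R) : (forall z w, `|f z - f w| <= normc (z - w)) ->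
    cvgn (fun N => f (psum e N)).
  move=> fle; apply: cauchy_cvg; apply: cauchy_exP => eps eps0.
  have [N hN] := expN_small (B%:~R / (rho - 1)) rho_gt1 eps0.
  exists (f (psum e N)), N => // M /= NM.
  apply: le_lt_trans hN; apply: le_trans (fle _ _) _.
  by rewrite normcB; exact: psum_dist.
have cr : cvgn (fun N => complex.Re (psum e N)).
  by apply: cau => z w; rewrite -ReB; exact: norm_Re_le.
have ci : cvgn (fun N => complex.Im (psum e N)).
  by apply: cau => z w; rewrite -ImB; exact: norm_Im_le.
exists (Complex (limn (fun N => complex.Re (psum e N)))
                (limn (fun N => complex.Im (psum e N)))).
by split; [exact: cr|exact: ci].
Qed.

Lemma psum_tail (B : int) e z N : (forall j, `|e j| <= B) -> ccvg (psum e) z ->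
  normc (z - psum e N) <= B%:~R / (rho - 1) * rho ^- N.
Proof.
move=> eB ez; apply: (ccvg_normc_le (N0 := N) ez) => M NM; exact: psum_dist.
Qed.

(* For [c = 1] (digits of size at most [n^2], as for [Delta - Delta] when [D] lies in
   the lower half) and [c = 2] (the sparse case), a small series starts with a digit
   of at most this size. *)
Definition digit_gap (c : nat) : int :=
  if c == 1%N then 1 else if (5 <= n)%N then 2 else 3.

(** Coordinates of the Gaussian integers obtained by repeatedly multiplying by [-n + i] and adding a
    digit, which affects the real part only. *)
Fixpoint gauss_orbit (e : nat -> int) m : int * int :=
  if m is m'.+1 then
    let: (x, y) := gauss_orbit e m' in (- n%:Z * x - y + e m, x - n%:Z * y)
  else (e 0%N, 0).

(** Horner's rule: scaling clears all negative powers of the base, and the leading zeros only shift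
    the start of the orbit. *)
Lemma gauss_orbitE e k m : (forall j, (j < k)%N -> e j = 0) ->
  b ^+ (k + m).+1 * psum e (k + m).+1 =
  Complex ((gauss_orbit (fun j => e (k + j)%N) m).1)%:~R
          ((gauss_orbit (fun j => e (k + j)%N) m).2)%:~R.
Proof.
have b0 := base_neq0.
move=> e0; elim: m => [|m IH].
  rewrite addn0 /psum big_ord_recr /= big1; last first.
    by move=> j _; rewrite e0 ?mul0r.
  rewrite add0r mulrCA divff ?expf_neq0// mulr1 addn0.
  have -> : ((e k)%:~R : complex R) = (e k)%:~R%:C%C by rewrite rmorph_int.
  by [].
rewrite addnS /psum big_ord_recr /= -/(psum _ _) mulrDr.
rewrite [X in _ + X]mulrCA divff ?expf_neq0// mulr1 exprS -mulrA IH.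
case: (gauss_orbit _ m) => x y /=.
have -> : ((e (k + m).+1)%:~R : complex R) = (e (k + m).+1)%:~R%:C%C by rewrite rmorph_int.
rewrite addnS; apply/eqP; rewrite eq_complex /= mul1r; apply/andP; split; apply/eqP.
  by rewrite !(intrD, intrB, intrM, intrN).
by rewrite !(intrB, intrM) addr0; ring.
Qed.

(** The scaled partial sum is the scaled limit [w] minus a tail of modulus at most [A], because
    [n ^+ 2 / (rho - 1) = rho + 1]. If [w] is small, the orbit stays in the disc of radius [A'] up
    to index 6, and the orbit gaps apply. *)
Lemma psum_gap (c : nat) : c = 1%N \/ c = 2%N -> exists2 eta : R, 0 < eta &
  forall (e : nat -> int) k w, (forall j, `|e j| <= c%:Z * n%:Z ^+ 2) ->
    (forall j, (j < k)%N -> e j = 0) -> ccvg (psum e) w ->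
    normc w < eta * rho ^- k -> `|e k| <= digit_gap c.
Proof.
move=> c12.
pose A : R := c%:R * (rho + 1).
(* As [rho < n + 2^-1], the square of [rho + 1], which is [n ^+ 2 + 2 + 2 * rho], lies below
   [n ^+ 2 + 2 * n + 3]. The room [A' - A] is left for [w]. *)
pose A' : R := c%:R * Num.sqrt (n%:R ^+ 2 + 2 * n%:R + 3).
have n2' : 2 <= n%:R :> R by rewrite (ler_nat _ 2).
have c0 : 0 < c%:R :> R by case: c12 => ->.
have r0 := rho_gt0.
have AA' : A < A'.
  rewrite ltr_pM2l// -(ltr_pXn2r (n:=2)) ?nnegrE ?sqrtr_ge0//; last by lra.
  by rewrite sqr_sqrtr; have := rho_lt; have := rho_sqr; nra.
(* For indices [m <= 6] the scaling multiplies the modulus of [w] by at most [rho ^+ (k + 7)]. *)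
exists ((A' - A) / rho ^+ 7).
  by rewrite divr_gt0 ?subr_gt0 ?exprn_gt0.
move=> e k w eB e0 ew wlt.
have eB' j : `|e (k + j)%N| <= c%:Z * n%:Z ^+ 2 by [].
set o := gauss_orbit (fun j => e (k + j)%N).
have oB m : (m <= 6)%N ->
    (o m).1 ^+ 2 + (o m).2 ^+ 2 <= c%:Z ^+ 2 * (n%:Z ^+ 2 + 2 * n%:Z + 3).
  move=> m6; rewrite -(ler_int R) intrD !rmorphXn /=.
  have -> : ((o m).1)%:~R ^+ 2 + ((o m).2)%:~R ^+ 2 =
      normc (b ^+ (k + m).+1 * psum e (k + m).+1) ^+ 2.
    by rewrite gauss_orbitE// normc_sqr.
  have -> : (c%:Z ^+ 2 * (n%:Z ^+ 2 + 2 * n%:Z + 3))%:~R = A' ^+ 2.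
    by rewrite exprMn sqr_sqrtr; [rewrite !(intrM, intrD, rmorphXn)//= -!pmulrn|nra].
  rewrite ler_pXn2r ?nnegrE ?normc_ge0//; last by rewrite mulr_ge0 ?sqrtr_ge0.
  have -> : b ^+ (k + m).+1 * psum e (k + m).+1 =
     b ^+ (k + m).+1 * w + b ^+ (k + m).+1 * (psum e (k + m).+1 - w).
    by rewrite -mulrDr addrC subrK.
  apply: le_trans (normcD _ _) _; rewrite !normcM !normcX !normc_base.
  rewrite [normc (_ - w)]normcB.
  have h1 := psum_tail (k + m).+1 eB ew.
  have p0 : 0 < rho ^+ (k + m).+1 by rewrite exprn_gt0.
  have {}h1 : rho ^+ (k + m).+1 * normc (w - psum e (k + m).+1) <= A.
    have := ler_wpM2l (ltW p0) h1; rewrite mulrCA divff ?gt_eqF// mulr1.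
    have -> : (c%:Z * n%:Z ^+ 2)%:~R / (rho - 1) = A; last by [].
    rewrite intrM rmorphXn /= -!pmulrn.
    have -> : n%:R ^+ 2 = (rho - 1) * (rho + 1) :> R by have := rho_sqr; lra.
    rewrite /A; field; have := rho_gt1; lra.
  suff h2 : rho ^+ (k + m).+1 * normc w <= A' - A by lra.
  apply: ltW; apply: (@lt_le_trans _ _ (rho ^+ (k + m).+1 * ((A' - A) / rho ^+ 7 / rho ^+ k))).
    by rewrite ltr_pM2l.
  rewrite -addnS exprD.
  have -> : rho ^+ k * rho ^+ m.+1 * ((A' - A) / rho ^+ 7 / rho ^+ k) =
    (A' - A) * (rho ^+ m.+1 / rho ^+ 7).
    by field; rewrite !gt_eqF ?exprn_gt0.
  rewrite ger_pMr ?subr_gt0// ler_pdivrMr ?exprn_gt0// mul1r.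
  by apply: ler_weXn2l => //; exact/ltW/rho_gt1.
have oS m : (o m.+1).1 = - n%:Z * (o m).1 - (o m).2 + e (k + m.+1)%N.
  by rewrite /o /=; case: (gauss_orbit _ m).
have oS' m : (o m.+1).2 = (o m).1 - n%:Z * (o m).2.
  by rewrite /o /=; case: (gauss_orbit _ m).
have n2z : 2 <= n%:Z by lia.
have -> : e k = (o 0%N).1 by rewrite /o /= addn0.
case: c12 => cE; subst c; rewrite /digit_gap /=.
  apply: (gauss_orbit_gap1 (e := fun j => e (k + j)%N) n2z oS oS' erefl) => [m|m m6].
    by have := eB' m; rewrite mul1r.
  by have := oB m m6; rewrite mul1r.
exact: (gauss_orbit_gap2 (e := fun j => e (k + j)%N) n2z oS oS' erefl _ oB).
Qed.

End Series.

(** * Dimensions of coded sets *)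

Section Dimension.
Variables (R : realType) (r : R) (E : nat -> seq nat).
Variables (p : (nat -> nat) -> complex R) (A c lam c1 c2 : R).
Hypotheses (r1 : 1 < r) (E0 : forall j, (0 < size (E j))%N).
Hypothesis uE : forall j, uniq (E j).
Hypotheses (A0 : 0 < A) (c0 : 0 < c) (c10 : 0 < c1) (lam0 : 0 <= lam).
(** Together with [psep] this makes [p] bi-Lipschitz for the ultrametric in which sequences first
    differing at [k] are at distance [r ^- k]. *)
Hypothesis pnear : forall x y k, admissible E x -> admissible E y ->
  mkseq x k = mkseq y k -> cdist (p x) (p y) <= A * r ^- k.
Hypothesis psep : forall x y k, admissible E x -> admissible E y ->
  mkseq x k <> mkseq y k -> c * r ^- k <= cdist (p x) (p y).
Local Notation tau := (r `^ lam).
Local Notation M k := (size (words E k)).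
Hypothesis Mge : forall k, c1 * tau ^+ k <= (M k)%:R.
Hypothesis Mle : forall k, (M k)%:R <= c2 * tau ^+ k.

Local Notation T := [set p x | x in admissible E].

Let r0 : 0 < r. Proof. by move: r1; lra. Qed.
Let r_ge0 : 0 <= r. Proof. exact: ltW. Qed.
Let A_ge0 : 0 <= A. Proof. exact: ltW. Qed.
Let c_ge0 : 0 <= c. Proof. exact: ltW. Qed.
Let powr_gt0 s : 0 < r `^ s. Proof. exact: powR_gt0. Qed.

Let ratio_bounds s : lam < s -> 0 < tau / r `^ s < 1.
Proof.
move=> ls; rewrite divr_gt0//= ltr_pdivrMr// mul1r.
rewrite lt_neqAle ler_powR ?ltW// andbT; apply/eqP => h.
have /eqP : r `^ (s - lam) = 1.
  by rewrite powRB ?h ?divff ?gt_eqF//; apply/implyP.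
by rewrite powR_eq1 gt_eqF//= ltNge ltW//= subr_eq0 gt_eqF.
Qed.

Lemma c2_ge0 : 0 <= c2.
Proof. by have := Mle 0; rewrite expr0 mulr1; apply: le_trans; rewrite ler0n. Qed.

Lemma size_words_scale s k : (M k)%:R * (r `^ s) ^- k <= c2 * (tau / r `^ s) ^+ k.
Proof.
rewrite expr_div_n mulrA ler_pM2r ?Mle// invr_gt0 exprn_gt0//.
Qed.

(* Balls whose radius is of order [r^-k] have centres with distinct words of
   length [k], so there are at most [M k] of them. *)
Lemma packing_partial_le s k0 (x : nat -> nat -> nat) (rr : nat -> R) m :
  lam < s -> 0 < s ->
  (forall i, admissible E (x i)) ->
  (forall i, 0 <= rr i <= A * r ^- k0.+1) ->
  (forall i j, i <> j -> 0 < rr i -> 0 < rr j ->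
     cball (p (x i)) (rr i) `&` cball (p (x j)) (rr j) = set0) ->
  \sum_(i < m) (2 * rr i) `^ s <=
  (2 * A * r) `^ s * c2 * (tau / r `^ s) ^+ k0.+1 / (1 - tau / r `^ s).
Proof.
move=> ls s0 xE rB disj; set t := tau / r `^ s.
have /andP[t0 t1] := ratio_bounds ls.
(* The level of a ball is the least [k] with [A * r ^- k] at most its radius. Balls of radius 0 are
   padding: they get level 0 and drop out of the sum. *)
pose lev i := if pselect (0 < rr i) is left h then
  sval (cid (scale_level A r1 h)) else 0%N.
have levP i : 0 < rr i -> [/\ (k0 < lev i)%N, A * r ^- lev i <= rr i &
    rr i <= A * r * r ^- lev i].
  rewrite /lev; case: pselect => // h _; case: cid => /= k [k1 k2].
  have kk : (k0 < k)%N.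
    rewrite ltnNge; apply/negP => kk0.
    have /andP[_ h1] := rB i; have h2 := le_trans k1 h1.
    move: h2; rewrite ler_pM2l// lef_pV2 ?posrE ?exprn_gt0//.
    by rewrite ler_eXn2l// leqNgt ltnS kk0.
  split=> //; case: k k1 k2 kk => // k _ /(_ k (ltnSn k)) h2 _.
  by rewrite exprS invfM mulrA -[A * r / r]mulrA divff ?gt_eqF// mulr1 ltW.
rewrite (bigID (fun i : 'I_m => 0 < rr i)) /= [X in _ + X]big1 ?addr0; last first.
  move=> i; rewrite -leNgt => h; have /andP[h' _] := rB i.
  have -> : rr i = 0 by lra.
  by rewrite mulr0 powR0// gt_eqF.
pose K := (\max_(i < m) lev i).+1.
have levK (i : 'I_m) : (lev i - k0.+1 < K)%N.
  by rewrite ltnS; apply: leq_trans (leq_subr _ _) (leq_bigmax_cond _ _).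
(* Grouped by level, the balls contribute at most one geometric term for each level beyond [k0]. *)
rewrite (partition_big (fun i => Ordinal (levK i)) xpredT) //=.
apply: (@le_trans _ _ (\sum_(l < K)
    ((2 * A * r) `^ s * c2 * t ^+ k0.+1) * t ^+ l)); last first.
  rewrite -mulr_sumr; apply: ler_wpM2l; last first.
    by apply: geometric_partial_le; rewrite t1 ltW.
  by rewrite !mulr_ge0 ?powR_ge0 ?c2_ge0// exprn_ge0// ltW.
apply: ler_sum => l _; set k := (k0.+1 + l)%N.
have lk (i : 'I_m) : (0 < rr i) && (Ordinal (levK i) == l) -> lev i = k.
  by case/andP => /levP[h _ _] /eqP/(congr1 val) /= h'; rewrite /k -h' subnKC.
apply: (@le_trans _ _ (\sum_(i < m | (0 < rr i) && (Ordinal (levK i) == l))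
     (2 * A * r) `^ s * (r `^ s) ^- k)).
  apply: ler_sum => i hi; have /andP[ri _] := hi; have [_ _] := levP i ri.
  rewrite (lk i hi) => h; rewrite -powR_scale ?mulr_ge0//.
  apply: ge0_ler_powR; rewrite ?nnegrE ?mulr_ge0 ?invr_ge0 ?exprn_ge0//; [exact: ltW..|].
  by rewrite -!mulrA ler_pM2l// mulrA.
rewrite sumr_const -[leLHS]mulr_natl.
rewrite -[leRHS]mulrA -exprD -/k -[leRHS]mulrA.
rewrite [leLHS]mulrCA ler_wpM2l ?powR_ge0//.
apply: le_trans (size_words_scale s k).
rewrite ler_pM2r ?invr_gt0 ?exprn_gt0// ler_nat.
rewrite cardE -(size_map (fun i : 'I_m => mkseq (x i) k)).
apply: uniq_leq_size => [|u /mapP[i _ ->]]; last exact: mem_words.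
rewrite map_inj_in_uniq ?enum_uniq// => i j; rewrite !mem_enum => hi hj eqw.
(* Two balls of the same level with the same word would both contain [p (x j)]. *)
apply/val_inj/eqP; apply: contraT => /eqP ij.
have /andP[ri _] := hi; have /andP[rj _] := hj.
have [_ hri _] := levP i ri; rewrite (lk i hi) in hri.
have := disj _ _ ij ri rj; rewrite -subset0 => /(_ (p (x j))) [].
split; last by rewrite /cball /= cdistzz ltW.
exact: le_trans (pnear (xE i) (xE j) eqw) hri.
Qed.

(** The bound of [packing_partial_le] is a tail of a convergent geometric series, hence below [e]
    once [k0] is large. *)
Lemma packing_delta_small s (e : R) : lam < s -> 0 < s -> 0 < e ->
  exists2 d : R, 0 < d & (packing_delta s d T <= e%:E)%E.
Proof.
move=> ls s0 e0; have /andP[t0 t1] := ratio_bounds ls.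
set t := tau / r `^ s in t0 t1 *.
have ti1 : 1 < t^-1 by rewrite invf_gt1.
have [k0 hk0] := expN_small ((2 * A * r) `^ s * c2 / (1 - t)) ti1 e0.
exists (A * r ^- k0.+1); first by rewrite mulr_gt0 ?invr_gt0 ?exprn_gt0.
apply: ge_ereal_sup => _ [[[cc rr] /= [cT disj] <-]|->]; last by rewrite lee_fin ltW.
have ex i : exists x, admissible E x /\ p x = cc i.
  by have [[x xE xc] _] := cT i; exists x.
have [x xP] := choice ex.
have xE i : admissible E (x i) := (xP i).1.
have cE : cc = fun i => p (x i) by apply/funext => i; rewrite (xP i).2.
apply: nneseries_EFin_le => [i|m]; first exact: powR_ge0.
apply: le_trans (packing_partial_le (k0 := k0) m ls s0 xE _ _) _.
- by move=> i; exact: (cT i).2.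
- by move=> i j ij ri rj; have := disj i j ij ri rj; rewrite cE.
rewrite -/t; apply: le_trans (ltW hk0); rewrite exprVn invrK.
rewrite mulrAC ler_wpM2l//; last by rewrite exprS ger_pMl ?exprn_gt0 ?ltW.
by rewrite !mulr_ge0 ?powR_ge0 ?c2_ge0// invr_ge0; lra.
Qed.

Lemma packing_delta_ge0 s d F : (0 <= packing_delta s d F :> \bar R)%E.
Proof. by apply: ereal_sup_ubound; right. Qed.

Lemma packing_pre_ge0 s F : (0 <= packing_pre s F :> \bar R)%E.
Proof. by apply: le_ereal_inf_tmp => _ [d _ <-]; exact: packing_delta_ge0. Qed.

Lemma packing_measure0 s : lam < s -> 0 < s -> packing_measure s T = 0%E.
Proof.
move=> ls s0; apply/eqP; rewrite eq_le; apply/andP; split; last first.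
  apply: le_ereal_inf_tmp => _ [F _ <-]; apply: nneseries_ge0 => i _ _.
  exact: packing_pre_ge0.
have pre0 : packing_pre s T = 0%E.
  apply/eqP; rewrite eq_le packing_pre_ge0 andbT.
  apply/lee_addgt0Pr => e e0; rewrite add0e.
  have [d d0 hd] := packing_delta_small ls s0 e0.
  by apply: ge_ereal_inf; exists (packing_delta s d T) => //; exists d.
apply: ge_ereal_inf; exists 0%E => //; exists (fun=> T); first by move=> z Tz; exists 0%N.
by rewrite pre0 eseries0.
Qed.

Lemma diam_le (U : set (complex R)) (B : R) : 0 <= B ->
  (forall x y, U x -> U y -> cdist x y <= B) -> (diam U <= B%:E)%E.
Proof.
move=> B0 UB; apply: ge_ereal_sup => _ [[x Ux [y Uy <-]]|->]; rewrite lee_fin//.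
exact: UB.
Qed.

Lemma diam_ge0 (U : set (complex R)) : (0 <= diam U)%E.
Proof. by apply: ereal_sup_ubound; right. Qed.

(** Covering by the [M k] cylinders of length [k], of diameter at most [A * r ^- k], costs a
    constant times [t ^+ k] with [t < 1]. *)
Lemma hausdorff_measure0 s : lam < s -> 0 < s -> hausdorff_measure s T = 0%E.
Proof.
move=> ls s0; have /andP[t0 t1] := ratio_bounds ls.
set t := tau / r `^ s in t0 t1 *.
have ti1 : 1 < t^-1 by rewrite invf_gt1.
suff hd (d : R) : 0 < d -> hausdorff_delta s d T = 0%E.
  apply/eqP; rewrite eq_le; apply/andP; split.
    by apply: ge_ereal_sup => _ [d /hd -> <-].
  by apply: ereal_sup_ubound; exists 1; rewrite /= ?hd.
move=> d0; apply/eqP; rewrite eq_le; apply/andP; split; last first.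
  by apply: le_ereal_inf_tmp => _ [U _ <-]; apply: nneseries_ge0 => i _ _;
    rewrite lee_fin powR_ge0.
apply/lee_addgt0Pr => e e0; rewrite add0e.
have [k0 hk0] := expN_small (A `^ s * c2) ti1 e0.
have [k1 hk1] := expN_small A r1 d0.
pose k := maxn k0 k1.
have hkd : A * r ^- k <= d.
  apply: le_trans (ltW hk1); rewrite ler_pM2l// lef_pV2 ?posrE ?exprn_gt0//.
  by rewrite ler_eXn2l// leq_maxr.
have hke : A `^ s * c2 * t ^+ k <= e.
  apply: le_trans (ltW hk0); rewrite exprVn invrK ler_wpM2l ?mulr_ge0 ?powR_ge0 ?c2_ge0//.
  by rewrite ler_wiXn2l// ?ltW// leq_maxl.
(* Cylinders are numbered by the position of their word in the list; numbers from [M k] on give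
   empty sets, of diameter 0. *)
pose U i := [set p x | x in [set x | admissible E x /\
   index (mkseq x k) (words E k) = i]].
have Uk i : (diam (U i) <= (if (i < M k)%N then A * r ^- k else 0)%:E)%E.
  apply: diam_le; first by case: ifP => // _; rewrite mulr_ge0 ?invr_ge0 ?exprn_ge0// ltW.
  move=> _ _ [x [xE xi] <-] [y [yE yi] <-].
  rewrite -{1}xi index_mem mem_words//; apply: pnear => //.
  by rewrite -(nth_index [::] (mem_words k xE)) xi -yi nth_index// mem_words.
apply: ge_ereal_inf; eexists.
  exists U; last by reflexivity.
  split=> [_ [x xE <-]|i].
    by exists (index (mkseq x k) (words E k)) => //; exists x.
  apply: le_trans (Uk i) _; rewrite lee_fin.
  by case: ifP => // _; rewrite ltW.
apply: nneseries_EFin_le => [i|m]; first exact: powR_ge0.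
apply: le_trans hke.
apply: (@le_trans _ _ (\sum_(i < m) if (i < M k)%N then A `^ s * (r `^ s) ^- k else 0)).
  apply: ler_sum => i _; have := Uk i.
  have := diam_ge0 (U i); case: (diam (U i)) => [v| |]//=; rewrite !lee_fin => v0.
  case: ifP => _ hv.
    rewrite -powR_scale//; apply: ge0_ler_powR; rewrite ?nnegrE//; first exact: ltW.
    by rewrite mulr_ge0 ?invr_ge0 ?exprn_ge0.
  have -> : v = 0 by lra.
  by rewrite powR0// gt_eqF.
have rk0 : 0 <= (r `^ s) ^- k by rewrite invr_ge0 exprn_ge0// powR_ge0.
apply: le_trans (sum_ord_lt_le m (M k) (mulr_ge0 (powR_ge0 A s) rk0)) _.
rewrite mulrCA -[leRHS]mulrA; apply: ler_wpM2l; first exact: powR_ge0.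
exact: size_words_scale.
Qed.

(** Mass distribution principle, on which both lower bounds rest. By compactness finitely many
    families already cover, so their masses add up to at least 1, and the slack terms account for at
    most half of it. *)
Lemma cover_content (G : R) (k : nat -> nat) (P : nat -> pred (seq nat))
    (a : nat -> R) : 0 < G ->
  (forall x, admissible E x -> exists i, P i (mkseq x (k i))) ->
  (forall i, (count (P i) (words E (k i)))%:R / (M (k i))%:R <=
     G * (a i + (2 * G)^-1 * 2 ^- i.+1)) ->
  exists m, (2 * G)^-1 <= \sum_(i < m) a i.
Proof.
move=> G0 cov wB; have [m mcov] := finite_subcover cov.
exists m; have h := finite_cover_weight E0 R mcov.
have {}h := le_trans h (ler_sum _ (fun i _ => wB (nat_of_ord i))).
rewrite -mulr_sumr big_split /= -mulr_sumr in h.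
have h2 := half_series_le R m.
have h3 : (2 * G)^-1 * \sum_(i < m) 2 ^- i.+1 <= (2 * G)^-1.
  by rewrite ger_pMr// invr_gt0 mulr_gt0.
have h4 : G * (2 * G)^-1 = 2^-1 by field; rewrite gt_eqF.
rewrite -(ler_pM2l G0) h4; have := ler_wpM2l (ltW G0) h3; rewrite h4 mulrDr in h *.
by move: h; lra.
Qed.

Lemma weight_le s k : s <= lam -> (M k)%:R^-1 <= c1^-1 * (r `^ s) ^- k.
Proof.
move=> sl; rewrite -invfM lef_pV2 ?posrE ?ltr0n ?size_words_gt0 ?mulr_gt0 ?exprn_gt0//.
apply: le_trans (Mge k); rewrite ler_pM2l//.
by apply: lerXn2r; rewrite ?nnegrE ?powR_ge0// ler_powR// (ltW r1).
Qed.

Lemma powRVK (s e : R) : 0 < s -> 0 <= e -> (e `^ s^-1) `^ s = e.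
Proof. by move=> s0 e0; rewrite -powRrM mulVf ?gt_eqF// powRr1. Qed.

(** A set of diameter below [c * r ^- k] meets at most one cylinder of length [k], whose mass
    [weight_le] controls. Scale 1 suffices because the measure is a supremum over scales. *)
Lemma hausdorff_measure_neq0 s : 0 < s -> s <= lam -> hausdorff_measure s T <> 0%E.
Proof.
move=> s0 sl.
pose G := c1^-1 * r `^ s / c `^ s.
have cs0 : 0 < c `^ s by rewrite powR_gt0.
have G0 : 0 < G by rewrite divr_gt0// mulr_gt0// invr_gt0.
suff : ((2 * G)^-1%:E <= hausdorff_delta s 1 T)%E.
  move=> h h0; have : (hausdorff_delta s 1 T <= hausdorff_measure s T)%E.
    by apply: ereal_sup_ubound; exists 1 => //=.
  rewrite h0 => /(le_trans h); rewrite lee_fin leNgt invr_gt0 mulr_gt0//.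
apply: le_ereal_inf_tmp => _ [U [cov Ud] <-].
pose a i := fine (diam (U i)) `^ s.
have eps0 i : 0 < (2 * G)^-1 * 2 ^- i.+1 :> R.
  by rewrite mulr_gt0 ?invr_gt0 ?exprn_gt0// mulr_gt0.
(* The maximum keeps [rr i] positive even for sets of diameter 0, so that a level exists; the price
   is the slack of [cover_content]. *)
pose rr i := Num.max (fine (diam (U i))) (((2 * G)^-1 * 2 ^- i.+1) `^ s^-1).
have rr0 i : 0 < rr i by rewrite lt_max powR_gt0 ?orbT.
(* With the constant [c / r], minimality gives [rr i < c * r ^- k i] unless [k i = 0]: just below
   the separation of distinct words. *)
have [k kP] := choice (fun i => scale_level (c / r) r1 (rr0 i)).
pose P i u := `[< exists x, [/\ admissible E x, U i (p x) & mkseq x (k i) = u] >].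
have Pu i x y : admissible E x -> admissible E y -> U i (p x) -> U i (p y) ->
    mkseq x (k i) = mkseq y (k i).
  move=> xE yE Ux Uy; apply: contrapT => neq; have := psep xE yE neq.
  move: neq (kP i); case: (k i) => [//|k'] _ [_ /(_ k' (ltnSn _))].
  rewrite -mulrA -invfM -exprS => h1 h2.
  have : cdist (p x) (p y) <= fine (diam (U i)).
    (* The scale bound 1 makes the diameter finite, so [fine] does not alter it. *)
    rewrite -lee_fin fineK; last first.
      by rewrite ge0_fin_numE ?diam_ge0// (le_lt_trans (Ud i)) ?ltry.
    by apply: ereal_sup_ubound; left; exists (p x) => //; exists (p y).
  have : fine (diam (U i)) <= rr i by rewrite le_max lexx.
  by lra.
have covP x : admissible E x -> exists i, P i (mkseq x (k i)).
  by move=> xE; have [i _ Ui] := cov (p x) (imageP _ xE); exists i; apply/asboolP; exists x.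
have wB i : (count (P i) (words E (k i)))%:R / (M (k i))%:R <=
     G * (a i + (2 * G)^-1 * 2 ^- i.+1).
  have cnt : (count (P i) (words E (k i)) <= 1)%N.
    rewrite -size_filter; case fE : (seq.filter _ _) => [|u [|v s']] //.
    have : uniq [:: u, v & s'] by rewrite -fE filter_uniq ?uniq_words.
    have memP w : w \in [:: u, v & s'] ->
        exists x, [/\ admissible E x, U i (p x) & mkseq x (k i) = w].
      by rewrite -fE mem_filter => /andP[/asboolP].
    have [x [xE xU <-]] := memP u (mem_head _ _).
    have [|y [yE yU <-]] := memP v; first by rewrite !inE eqxx orbT.
    by rewrite (Pu i x y)//= mem_head.
  have rrs : rr i `^ s <= a i + (2 * G)^-1 * 2 ^- i.+1.
    rewrite /rr; case: (leP (fine (diam (U i)))) => _; last by rewrite lerDl ltW.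
    by rewrite (powRVK s0 (ltW (eps0 i))) lerDr powR_ge0.
  have [kr _] := kP i.
  apply: (@le_trans _ _ ((M (k i))%:R^-1)).
    by rewrite ler_piMl ?invr_ge0// lern1.
  apply: le_trans (weight_le (k i) sl) _.
  apply: (@le_trans _ _ (G * rr i `^ s)); last by rewrite ler_pM2l.
  apply: (@le_trans _ _ (G * (c / r * r ^- k i) `^ s)); last first.
    rewrite ler_pM2l//; apply: ge0_ler_powR; rewrite ?nnegrE ?mulr_ge0 ?invr_ge0 ?exprn_ge0//.
      exact: ltW.
    exact: ltW.
  rewrite powR_scale ?divr_ge0// powRM ?invr_ge0//.
  rewrite -(powR_inv1 r_ge0) powRAC powR_inv1 ?powR_ge0// /G.
  have rs0 : r `^ s != 0 by rewrite gt_eqF.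
  have cs1 : c `^ s != 0 by rewrite gt_eqF.
  have c11 : c1 != 0 by rewrite gt_eqF.
  rewrite le_eqVlt; apply/orP; left; apply/eqP.
  move: (_ ^- k i) => q; field.
  by rewrite c11 rs0 cs1.
have [m hm] := cover_content G0 covP wB.
apply: le_trans (nneseries_EFin_ge m _); first by rewrite lee_fin.
by move=> i; exact: powR_ge0.
Qed.

(** Choose one point of [F] for each word of length [k] that occurs there; balls around them of
    radius a third of the separation are disjoint. *)
Lemma packing_delta_ge s k (d : R) (F : set (complex R)) : 0 < s ->
  c / 3 * r ^- k <= d ->
  (((c / 3 * 2 * r ^- k) `^ s *
    (count (fun u => `[< exists x, [/\ admissible E x, F (p x) & mkseq x k = u] >])
          (words E k))%:R)%:E <= packing_delta s d F)%E.
Proof.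
move=> s0 kd; rewrite -size_filter.
set L := seq.filter _ _.
have rk0 : 0 < r ^- k by rewrite invr_gt0 exprn_gt0.
case LE : L => [|u0 L']; first by rewrite mulr0 packing_delta_ge0.
rewrite -LE.
have LP u : u \in L -> exists x, [/\ admissible E x, F (p x) & mkseq x k = u].
  by rewrite mem_filter => /andP[/asboolP].
have uL : uniq L by rewrite filter_uniq ?uniq_words.
(* The default [u0] is itself in [L], so every index has a centre; past the end of [L] the radius is
   0. *)
have nL j : nth u0 L j \in L.
  have [jL|jL] := ltnP j (size L); first exact: mem_nth.
  by rewrite nth_default// LE mem_head.
have [g gP] := choice (fun j => LP _ (nL j)).
pose rad j : R := if (j < size L)%N then c / 3 * r ^- k else 0.
apply: (@le_trans _ _ (\sum_(i <oo) ((2 * rad i) `^ s)%:E)%E); last first.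
  apply: ereal_sup_ubound; left; exists (fun j => p (g j), rad) => //=; split.
    move=> i; split; first by have [] := gP i.
    rewrite /rad; case: ifP => _; first by rewrite kd mulr_ge0 ?divr_ge0 ?ltW.
    rewrite lexx /=; apply: le_trans kd.
    by rewrite mulr_ge0 ?divr_ge0// ltW.
  move=> i j ij; rewrite /rad; case: ifP => iL; last by rewrite ltxx.
  case: ifP => jL; last by rewrite ltxx.
  move=> _ _; rewrite -subset0 => z [/=]; rewrite /cball /= => zi zj.
  have [giE _ giw] := gP i; have [gjE _ gjw] := gP j.
  have neq : mkseq (g i) k <> mkseq (g j) k.
    rewrite giw gjw => /eqP; rewrite nth_uniq// => /eqP; exact: ij.
  have := psep giE gjE neq; have := cdist_triangle z (p (g i)) (p (g j)).
  rewrite [cdist z _]cdistC; have : 0 < c * r ^- k by rewrite mulr_gt0.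
  by move: zi zj; rewrite mulrAC; lra.
apply: le_trans (nneseries_EFin_ge (size L) _); last by move=> i; exact: powR_ge0.
rewrite lee_fin (eq_bigr (fun=> (c / 3 * 2 * r ^- k) `^ s)); last first.
  by move=> i _; rewrite /rad ltn_ord mulrA [2 * (c / 3)]mulrC.
by rewrite sumr_const card_ord mulr_natr.
Qed.

(** For each piece of a cover, take a scale at which the packing sum is within the slack of the
    premeasure. Then [packing_delta_ge] bounds the number of words the piece meets, hence its
    mass. *)
Lemma packing_measure_neq0 s : 0 < s -> s <= lam -> packing_measure s T <> 0%E.
Proof.
move=> s0 sl.
pose G := c1^-1 / (c / 3 * 2) `^ s.
have cs0 : 0 < (c / 3 * 2) `^ s by rewrite powR_gt0// !mulr_gt0.
have G0 : 0 < G by rewrite divr_gt0// invr_gt0.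
suff : ((2 * G)^-1%:E <= packing_measure s T)%E.
  by move=> h h0; move: h; rewrite h0 lee_fin leNgt invr_gt0 mulr_gt0.
apply: le_ereal_inf_tmp => _ [F cov <-].
set S := (\sum_(i <oo) _)%E.
have pre0 i : (0 <= packing_pre s (F i))%E by exact: packing_pre_ge0.
have preS m : (\sum_(i < m) packing_pre s (F i) <= S)%E.
  by rewrite -(big_mkord xpredT (fun i => packing_pre s (F i)))
    nneseries_lim_ge// => i _ _.
(* Once the sum is finite, every premeasure is finite and may be treated as a real number. *)
have [Sinf|/eqP Sfin] := eqVneq S +oo%E; first by rewrite Sinf leey.
have prefin i : packing_pre s (F i) \is a fin_num.
  rewrite ge0_fin_numE//; apply: (@le_lt_trans _ _ S); last by rewrite ltey; apply/eqP.
  apply: le_trans (preS i.+1); rewrite big_ord_recr /= leeDr//.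
  by apply: sume_ge0 => j _.
pose a i := fine (packing_pre s (F i)).
have eps0 i : 0 < (2 * G)^-1 * 2 ^- i.+1 :> R.
  by rewrite mulr_gt0 ?invr_gt0 ?exprn_gt0// mulr_gt0.
have ex i : exists dk : R * nat, [/\ 0 < dk.1, c / 3 * r ^- dk.2 <= dk.1 &
   (packing_delta s dk.1 (F i) <= (a i + (2 * G)^-1 * 2 ^- i.+1)%:E)%E].
  have [_ [d d0 <-] hd] := lb_ereal_inf_adherent (eps0 i) (prefin i).
  have [k /ltW hk] := expN_small (c / 3) r1 d0.
  by exists (d, k); split=> //=; rewrite EFinD fineK// ltW.
have [dk dkP] := choice ex.
pose k i := (dk i).2.
pose P i u := `[< exists x, [/\ admissible E x, F i (p x) & mkseq x (k i) = u] >].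
have covP x : admissible E x -> exists i, P i (mkseq x (k i)).
  by move=> xE; have [i _ Ui] := cov (p x) (imageP _ xE); exists i; apply/asboolP; exists x.
have wB i : (count (P i) (words E (k i)))%:R / (M (k i))%:R <=
     G * (a i + (2 * G)^-1 * 2 ^- i.+1).
  have [d0 kd hd] := dkP i.
  have := le_trans (packing_delta_ge (F i) s0 kd) hd.
  rewrite lee_fin -/(k i) -/(P i); set N := count _ _ => hN.
  apply: (@le_trans _ _ (G * ((c / 3 * 2 * r ^- k i) `^ s * N%:R))); last first.
    by rewrite ler_pM2l.
  rewrite mulrA mulrC ler_wpM2r//.
  apply: le_trans (weight_le (k i) sl) _.
  rewrite powR_scale ?mulr_ge0 ?divr_ge0// /G mulrA divfK ?gt_eqF//.
have [m hm] := cover_content G0 covP wB.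
apply: le_trans (preS m).
rewrite (eq_bigr (fun i : 'I_m => (a i)%:E)); last by move=> i _; rewrite fineK.
by rewrite sumEFin lee_fin.
Qed.

Theorem dimH_coded : dimH T = lam%:E.
Proof.
apply/eqP; rewrite eq_le; apply/andP; split.
  apply/lee_addgt0Pr => e e0; have le : lam < lam + e by rewrite ltrDl.
  have e1 := le_lt_trans lam0 le.
  apply: ereal_inf_lbound; exists (lam + e) => //.
  by split=> //; exact: hausdorff_measure0.
apply: le_ereal_inf_tmp => _ [s [s0 hs] <-]; rewrite lee_fin leNgt.
by apply/negP => /ltW /(hausdorff_measure_neq0 s0); apply.
Qed.

Theorem dimP_coded : dimP T = lam%:E.
Proof.
apply/eqP; rewrite eq_le; apply/andP; split.
  apply/lee_addgt0Pr => e e0; have le : lam < lam + e by rewrite ltrDl.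
  have e1 := le_lt_trans lam0 le.
  apply: ereal_inf_lbound; exists (lam + e) => //.
  by split=> //; exact: packing_measure0.
apply: le_ereal_inf_tmp => _ [s [s0 hs] <-]; rewrite lee_fin leNgt.
by apply/negP => /ltW /(packing_measure_neq0 s0); apply.
Qed.

End Dimension.

(** * Expansions with digits in [D] *)

Section Expansions.
Variables (R : realType) (n : nat) (D : set nat).
Hypothesis n2 : (2 <= n)%N.
Hypothesis Dn : D `<=` [set k | (k <= n ^ 2)%N].
Hypothesis Dgap : (D `<=` [set k | (k <= (n ^ 2)./2)%N] /\
     (forall d d', diffset D d -> diffset D d' -> `|d - d'| != 1))
   \/ sparse n (diffset D).
Local Notation rho := (rho R n).

Let sqrn : n%:Z ^+ 2 = (n ^ 2)%N :> int. Proof. by rewrite expr2 -PoszM mulnn. Qed.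

(** For [D] in the lower half the coefficients are at most [n ^ 2] in modulus, so [psum_gap] with
    [c = 1] leaves the absolute values 0 and 1, and 1 is excluded. In the sparse case they are at
    most [2 * n ^ 2], and the gap for [c = 2] is exactly the threshold in [sparse]. *)
Lemma diffset_gap : exists2 eta : R, 0 < eta &
  forall (e : nat -> int) k w,
    (forall j, exists2 d, diffset D d & exists2 d', diffset D d' & e j = d - d') ->
    (forall j, (j < k)%N -> e j = 0) -> ccvg (psum R n e) w ->
    normc w < eta * rho ^- k -> e k = 0.
Proof.
case: Dgap => [[Dh D1]|Dsp].
  have [eta eta0 h] := psum_gap R n2 (or_introl erefl : 1%N = 1%N \/ 1%N = 2%N).
  exists eta => // e k w eD e0 ew wlt.
  have := h e k w _ e0 ew wlt.
  have [d dD [d' d'D ->]] := eD k.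
  have := D1 _ _ dD d'D; rewrite /digit_gap /=; move: (d - d') => t t1 ht.
  suff : `|t| <= 1 by lia.
  apply: ht => j; have [_ [a /Dh /= aD [b /Dh /= bD <-]]
    [_ [a' /Dh /= a'D [b' /Dh /= b'D <-]] ->]] := eD j.
  rewrite sqrn; move: (n ^ 2)%N aD bD a'D b'D => N; lia.
have [eta eta0 h] := psum_gap R n2 (or_intror erefl : 2%N = 1%N \/ 2%N = 2%N).
exists eta => // e k w eD e0 ew wlt.
have := h e k w _ e0 ew wlt.
have [d dD [d' d'D ->]] := eD k.
rewrite /digit_gap /= => ht; apply: contrapT => /eqP; rewrite subr_eq0 => /eqP dd'.
have := Dsp _ _ dD d'D dd'.
have : `|d - d'| <= (if (5 <= n)%N then 2 else 3).
  apply: ht => j; have [_ [a /Dn /= aD [b /Dn /= bD <-]]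
    [_ [a' /Dn /= a'D [b' /Dn /= b'D <-]] ->]] := eD j.
  rewrite sqrn; move: (n ^ 2)%N aD bD a'D b'D => N; lia.
by case: ifP => _; lia.
Qed.

(** * Coding by digit sequences *)

Definition dseq : seq nat := [seq k <- iota 0 (n ^ 2).+1 | `[< D k >]].

Lemma mem_dseq k : k \in dseq <-> D k.
Proof.
rewrite mem_filter mem_iota /= add0n ltnS; split=> [/andP[/asboolP]//|Dk].
by apply/andP; split; [apply/asboolP|exact: Dn].
Qed.

Lemma dseq_uniq : uniq dseq.
Proof. by rewrite filter_uniq// iota_uniq. Qed.

Lemma dseq_le k : k \in dseq -> (k <= n ^ 2)%N.
Proof. by move=> /mem_dseq /Dn. Qed.

Let dig (x : nat -> nat) (j : nat) : int := (x j)%:Z.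
Local Notation adm := (admissible (fun=> dseq)).

(** On admissible sequences the series converges, so the default 0 does not intervene
    ([code_ccvg]). *)
Definition code (x : nat -> nat) : complex R :=
  xget 0 [set z | ccvg (psum R n (dig x)) z].

Lemma code_ccvg x : adm x -> ccvg (psum R n (dig x)) (code x).
Proof.
move=> xD; have [|z zP] := @psum_ccvg R n n2 (n ^ 2)%N%:Z (dig x).
  by move=> j; rewrite /dig; have := dseq_le (xD j); lia.
by rewrite /code; case: xgetP => [y -> //|/(_ z)].
Qed.

Lemma code_diff_ccvg x y : adm x -> adm y ->
  ccvg (psum R n (fun j => dig x j - dig y j)) (code x - code y).
Proof.
move=> xD yD; have := ccvgB (code_ccvg xD) (code_ccvg yD).
by rewrite (_ : (fun N => _) = psum R n (fun j => dig x j - dig y j))//;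
  apply/funext => N; rewrite psumB.
Qed.

Lemma CnDE : CnD R n D = [set code x | x in adm].
Proof.
have sumE (d : nat -> nat) :
    (fun N => \sum_(1 <= j < N.+1) ((d j)%:R : complex R) * base R n ^- j) =
    psum R n (dig (fun j => d j.+1)).
  by apply/funext => N; rewrite big_add1 big_mkord; apply: eq_bigr.
apply/seteqP; split=> [z [d [dD zd]]|_ [x xD <-]].
  have {zd} : ccvg (fun N => \sum_(1 <= j < N.+1)
    ((d j)%:R : complex R) * base R n ^- j) z by [].
  have xD : adm (fun j => d j.+1) by move=> j; apply/mem_dseq.
  rewrite sumE => zd; exists (fun j => d j.+1) => //.
  exact: ccvg_unique (code_ccvg xD) zd.
(* In [CnD] digits count from 1; the entry at index 0 enters no sum but must still lie in [D]. *)
exists (fun j => x j.-1); split; first by move=> j; apply/mem_dseq.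
suff : ccvg (fun N => \sum_(1 <= j < N.+1)
    ((x j.-1)%:R : complex R) * base R n ^- j) (code x) by [].
by rewrite (sumE (fun j => x j.-1)); exact: code_ccvg.
Qed.

Lemma code_near x y k : adm x -> adm y -> mkseq x k = mkseq y k ->
  cdist (code x) (code y) <= (n%:R ^+ 2 / (rho - 1)) * rho ^- k.
Proof.
move=> xD yD xy; rewrite cdistE.
have tail := @psum_tail R n n2 (n ^ 2)%N%:Z _ _ k _ (code_diff_ccvg xD yD).
have p0 : psum R n (fun j => dig x j - dig y j) k = 0.
  rewrite /psum big1// => j _.
  have : nth 0%N (mkseq x k) j = nth 0%N (mkseq y k) j by rewrite xy.
  by rewrite !nth_mkseq// /dig => ->; rewrite subrr mul0r.
have := tail; rewrite p0 subr0 -pmulrn natrX; apply.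
by move=> j; rewrite /dig; have := dseq_le (xD j); have := dseq_le (yD j); lia.
Qed.

Lemma diffset_dseq x y : x \in dseq -> y \in dseq -> diffset D (x%:Z - y%:Z).
Proof. by move=> /mem_dseq xD /mem_dseq yD; exists x => //; exists y. Qed.

Lemma mkseq_neq (x y : nat -> nat) k : mkseq x k <> mkseq y k ->
  exists2 j, (j < k)%N & x j <> y j /\ forall i, (i < j)%N -> x i = y i.
Proof.
move=> xy.
have ex : exists j, (j < k)%N && (x j != y j).
  apply: contrapT => h; apply: xy; apply/eq_in_map => j; rewrite mem_iota => /andP[_ jk].
  by apply: contrapT => /eqP ne; apply: h; exists j; rewrite jk.
case: (ex_minnP ex) => j /andP[jk /eqP ne] jmin; exists j => //; split=> // i ij.
apply: contrapT => /eqP ne'; have := jmin i; rewrite ne' (ltn_trans ij jk) => /(_ isT).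
by rewrite leqNgt ij.
Qed.

(** At the first index [j < k] of disagreement, a distance below [eta * rho ^- k], hence below
    [eta * rho ^- j], would force equal digits by [diffset_gap]. *)
Lemma code_sep : exists2 eta : R, 0 < eta &
  forall x y k, adm x -> adm y -> mkseq x k <> mkseq y k ->
    eta * rho ^- k <= cdist (code x) (code y).
Proof.
have [eta eta0 h] := diffset_gap; exists eta => // x y k xD yD /mkseq_neq[j jk [ne eqi]].
rewrite leNgt; apply/negP => lt; apply: ne; apply/eqP; rewrite -eqz_nat -subr_eq0; apply/eqP.
apply: (h (fun j => dig x j - dig y j) j (code x - code y)).
- move=> i; exists (dig x i - dig y i); first exact: diffset_dseq.
  (* Subtracting the zero difference presents the coefficient as a difference of two elements of
     [diffset D]. *)
  exists (dig x i - dig x i); first exact: diffset_dseq.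
  by rewrite subrr subr0.
- by move=> i /eqi; rewrite /dig => ->; rewrite subrr.
- exact: code_diff_ccvg.
- rewrite -cdistE; apply: lt_le_trans lt _; rewrite ler_pM2l//.
  rewrite lef_pV2 ?posrE ?exprn_gt0 ?rho_gt0// ler_eXn2l ?rho_gt1//.
  exact: ltnW.
Qed.

(** The difference of the two expansions sums to 0, and [diffset_gap] makes its coefficients vanish
    one after another. *)
Lemma code_diff_inj x y x' y' : adm x -> adm y -> adm x' -> adm y' ->
  code x - code y = code x' - code y' ->
  forall j, dig x j - dig y j = dig x' j - dig y' j.
Proof.
move=> xD yD x'D y'D eqc; have [eta eta0 h] := diffset_gap.
have cv := ccvgB (code_diff_ccvg xD yD) (code_diff_ccvg x'D y'D).
rewrite eqc subrr in cv.
have {}cv : ccvg (psum R n (fun j => (dig x j - dig y j) - (dig x' j - dig y' j))) 0.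
  by rewrite (_ : psum R n _ = (fun N => psum R n (fun j => dig x j - dig y j) N -
    psum R n (fun j => dig x' j - dig y' j) N))//; apply/funext => N; rewrite psumB.
elim/ltn_ind => j IH; apply/eqP; rewrite -subr_eq0; apply/eqP.
apply: (h (fun j => (dig x j - dig y j) - (dig x' j - dig y' j)) j 0) => //.
- move=> i; exists (dig x i - dig y i); first exact: diffset_dseq.
  by exists (dig x' i - dig y' i); first exact: diffset_dseq.
- by move=> i /IH ->; rewrite subrr.
- by rewrite normc0 mulr_gt0// invr_gt0 exprn_gt0 ?rho_gt0.
Qed.

(** This is the intersection of [D] with its translate by [d j - d' j], written with sums because
    subtraction in [nat] truncates. *)
Definition common_digits (d d' : nat -> nat) j : seq nat :=
  [seq x <- dseq | has (fun y => x + d' j == d j + y)%N dseq].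

Lemma common_digits_adm d d' x : admissible (common_digits d d') x -> adm x.
Proof. by move=> xE j; have := xE j; rewrite mem_filter => /andP[]. Qed.

Lemma common_digits_self d d' : adm d -> adm d' -> admissible (common_digits d d') d.
Proof.
by move=> dD d'D j; rewrite mem_filter dD andbT; apply/hasP; exists (d' j).
Qed.

(** By uniqueness, two points of [CnD] differ by the given translation only if their digits differ
    by [d j - d' j] at every [j]. *)
Lemma CalphaE d d' : adm d -> adm d' ->
  Calpha R n D (code d - code d') = [set code x | x in admissible (common_digits d d')].
Proof.
move=> dD d'D; rewrite /Calpha CnDE; apply/seteqP; split.
  move=> _ [[x xD <-] [y yD yE]]; exists x => // j; rewrite mem_filter xD andbT.
  apply/hasP; exists (y j); first exact: yD.
  have := code_diff_inj xD yD dD d'D _ j; rewrite yE opprB addrC subrK => /(_ erefl).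
  by rewrite /dig => h; apply/eqP; lia.
move=> _ [x xE <-]; have xD := common_digits_adm xE.
split; first by exists x.
have ex j : exists y, y \in dseq /\ (x j + d' j = d j + y)%N.
  by have := xE j; rewrite mem_filter => /andP[/hasP[y yD /eqP yE] _]; exists y.
have [y yP] := choice ex; have yD : adm y by move=> j; have [] := yP j.
exists y => //; have h : code x - code y = code d - code d'.
  apply: ccvg_unique (code_diff_ccvg xD yD) _.
  rewrite (_ : (fun j => _) = (fun j => dig d j - dig d' j)); first exact: code_diff_ccvg.
  by apply/funext => j; have [_] := yP j; rewrite /dig; lia.
by rewrite -h opprB addrC subrK.
Qed.

Lemma dim_code (E : nat -> seq nat) (lam c1 c2 : R) :
  (forall j, (0 < size (E j))%N) -> (forall j, uniq (E j)) ->
  (forall x, admissible E x -> adm x) ->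
  0 <= lam -> 0 < c1 ->
  (forall k, c1 * (rho `^ lam) ^+ k <= (size (words E k))%:R) ->
  (forall k, (size (words E k))%:R <= c2 * (rho `^ lam) ^+ k) ->
  dimH [set code x | x in admissible E] = lam%:E /\
  dimP [set code x | x in admissible E] = lam%:E.
Proof.
move=> E0 uE ED lam0 c10 Mge Mle; have [eta eta0 sep] := code_sep.
have n0 : 0 < n%:R :> R by rewrite ltr0n; lia.
have A0 : 0 < n%:R ^+ 2 / (rho - 1).
  by rewrite divr_gt0 ?exprn_gt0// subr_gt0 rho_gt1.
have near x y k : admissible E x -> admissible E y -> mkseq x k = mkseq y k ->
    cdist (code x) (code y) <= n%:R ^+ 2 / (rho - 1) * rho ^- k.
  by move=> /ED xD /ED yD; exact: code_near.
have {}sep x y k : admissible E x -> admissible E y -> mkseq x k <> mkseq y k ->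
    eta * rho ^- k <= cdist (code x) (code y).
  by move=> /ED xD /ED yD; exact: sep.
have r1 := rho_gt1 R n2.
split.
  exact: (dimH_coded r1 E0 uE A0 eta0 c10 lam0 near sep Mge Mle).
exact: (dimP_coded r1 E0 uE A0 eta0 c10 lam0 near sep Mge Mle).
Qed.

Local Notation p := (size dseq).
(** The similarity dimension: [p] maps of ratio [rho^-1]. *)
Definition dim_max : R := ln p%:R / ln rho.

Let ln_rho_gt0 : 0 < ln rho.
Proof. by rewrite ln_gt0// rho_gt1. Qed.

Lemma powR_dim_max : (0 < p)%N -> rho `^ dim_max = p%:R.
Proof.
move=> p0; rewrite /powR gt_eqF ?rho_gt0// divfK ?gt_eqF//.
by rewrite lnK// posrE ltr0n.
Qed.

Lemma dim_max_ge0 : (0 < p)%N -> 0 <= dim_max.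
Proof. by move=> p0; apply: divr_ge0; [rewrite ln_ge0// ler1n|exact: ltW]. Qed.

Lemma dim_CnD : (0 < p)%N ->
  dimH (CnD R n D) = dim_max%:E /\ dimP (CnD R n D) = dim_max%:E.
Proof.
move=> p0; rewrite CnDE; apply: (@dim_code _ dim_max 1 1) => //.
- by move=> j; exact: dseq_uniq.
- exact: dim_max_ge0.
- by move=> k; rewrite mul1r powR_dim_max// size_words prod_nat_const card_ord natrX.
- by move=> k; rewrite mul1r powR_dim_max// size_words prod_nat_const card_ord natrX.
Qed.

Lemma common_digits_size d d' j :
  adm d -> adm d' -> (0 < size (common_digits d d' j) <= p)%N.
Proof.
move=> dD d'D; apply/andP; split; last by rewrite size_filter count_size.
by have := common_digits_self dD d'D j; case: (common_digits _ _ _).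
Qed.

Lemma common_digits_diag d d' j : d j = d' j -> common_digits d d' j = dseq.
Proof.
move=> dj; apply/all_filterP/allP => x xD; apply/hasP; exists x => //.
by rewrite dj addnC.
Qed.

(** The largest possible digit difference is attained only by the pair of maximum and minimum. *)
Lemma common_digits_extreme d d' j : adm d -> adm d' ->
  (forall x, x \in dseq -> (d' j <= x <= d j)%N) -> size (common_digits d d' j) = 1%N.
Proof.
move=> dD d'D ext; apply/eqP; rewrite eqn_leq.
have /andP[-> _] := common_digits_size j dD d'D; rewrite andbT.
have : {subset common_digits d d' j <= [:: d j]}.
  move=> x; rewrite mem_filter inE => /andP[/hasP[y yD /eqP h] xD].
  by have := ext _ xD; have := ext _ yD; lia.
by apply: uniq_leq_size; rewrite filter_uniq// dseq_uniq.
Qed.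

(** * Nearby translations of prescribed dimension *)

Lemma truncn_step (theta : R) j : 0 <= theta <= 1 ->
  exists t : bool, Num.truncn (theta * j.+1%:R) = (Num.truncn (theta * j%:R) + t)%N.
Proof.
move=> /andP[t0 t1].
have le1 : (Num.truncn (theta * j%:R) <= Num.truncn (theta * j.+1%:R))%N.
  by apply: le_truncn; rewrite ler_wpM2l// ler_nat.
have le2 : (Num.truncn (theta * j.+1%:R) <= (Num.truncn (theta * j%:R)).+1)%N.
  rewrite truncn_le_nat -[in X in theta * X]natr1 mulrDr mulr1 -[in ltRHS]natr1.
  by have := truncnS_gt (theta * j%:R); lra.
exists (Num.truncn (theta * j%:R) < Num.truncn (theta * j.+1%:R))%N.
by case: ltnP; lia.
Qed.

Lemma level_point (lam : R) a e : 0 <= lam <= dim_max -> FnD R n D a -> 0 < e ->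
  exists alpha, [/\ FnD R n D alpha, dimH (Calpha R n D alpha) = lam%:E,
    dimP (Calpha R n D alpha) = lam%:E & cdist a alpha < e].
Proof.
move=> /andP[lam0 lamM] [z []]; rewrite CnDE => -[d dD <-] [d' d'D d'a] e0.
have aE : a = code d - code d' by rewrite d'a opprB addrC subrK.
have p0 : (0 < p)%N by have := dD 0%N; case: dseq.
pose theta := lam / dim_max.
have lamE : lam = theta * dim_max.
  (* When [dim_max] is 0, [lam] is 0 as well, and division by zero gives [theta = 0]. *)
  have [M0|M0] := eqVneq dim_max 0; last by rewrite /theta divfK.
  by rewrite M0 mulr0; apply/eqP; rewrite eq_le lam0 -M0 lamM.
have th : 0 <= theta <= 1.
  rewrite divr_ge0 ?dim_max_ge0//=.
  have [M0|M0] := eqVneq dim_max 0; first by rewrite /theta M0 invr0 mulr0.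
  by rewrite ler_pdivrMr ?mul1r// lt_neqAle eq_sym M0 dim_max_ge0.
have /andP[th0 th1] := th.
pose s j := Num.truncn (theta * j%:R).
have exD : exists x, x \in dseq by exists (d 0%N).
case: (ex_minnP exD) => mn mnD mnP.
case: (ex_maxnP exD dseq_le) => mx mxD mxP.
pose A := n%:R ^+ 2 / (rho - 1).
(* Changing both expansions after their first [K] digits moves their difference by at most
   [2 * A * rho ^- K]. *)
have [K hK] := expN_small (2 * A) (rho_gt1 R n2) e0.
pose g j := if (j < K)%N then d j else mx.
(* From [K] on, the digit difference is 0 where [s] jumps, which leaves all [p] digits, and
   [mx - mn] elsewhere, which leaves one. *)
pose g' j := if (j < K)%N then d' j else if (s j < s j.+1)%N then mx else mn.
have gD : adm g by move=> j; rewrite /g; case: ifP.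
have g'D : adm g' by move=> j; rewrite /g'; case: ifP => // _; case: ifP.
exists (code g - code g').
have tauE : rho `^ lam = p%:R `^ theta.
  by rewrite lamE mulrC powRrM powR_dim_max.
have [dH dP] : dimH [set code x | x in admissible (common_digits g g')] = lam%:E /\
  dimP [set code x | x in admissible (common_digits g g')] = lam%:E.
  (* The first [K] positions are uncontrolled; a factor [p] for each covers the discrepancy in both
     directions. *)
  pose w j := (if (j < K)%N then p else 1)%N.
  have wK k : (\prod_(j < k) w j <= p ^ K)%N.
    have [kK|kK] := leqP k K.
      apply: (@leq_trans (\prod_(j < k) p)); last first.
        by rewrite prod_nat_const card_ord leq_pexp2l.
      by apply: leq_prod => j _; rewrite /w; case: ifP.
    rewrite -(subnKC (ltnW kK)) big_split_ord /= [X in (_ * X)%N]big1 ?muln1; last first.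
      by move=> j _; rewrite /w /= ltnNge leq_addr.
    rewrite -[X in (_ <= _ ^ X)%N]card_ord -prod_nat_const; apply: leq_prod => j _.
    by rewrite /w; case: ifP.
  (* Jumps have size one, so the number of jumps before [k] is [s k]. *)
  have sE k : (\prod_(j < k) p ^ (s j < s j.+1) = p ^ s k)%N.
    elim: k => [|k IH]; first by rewrite big_ord0 /s mulr0 truncn0.
    rewrite big_ord_recr /= IH -expnD; congr (_ ^ _)%N.
    have [t] := truncn_step k th; rewrite -/(s k) -/(s k.+1) => ->.
    by case: t; case: ltnP; lia.
  have sz j : (size (common_digits g g' j) <= w j * p ^ (s j < s j.+1) /\
      p ^ (s j < s j.+1) <= w j * size (common_digits g g' j))%N.
    have /andP[c0 cp] := common_digits_size j gD g'D.
    rewrite /w; case: ifP => jK.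
      by case: (_ < _)%N; rewrite ?expn1 ?expn0; nia.
    rewrite !mul1n; case sj: (s j < s j.+1)%N.
      by rewrite common_digits_diag ?expn1// /g /g' jK sj.
    rewrite common_digits_extreme// /g /g' jK sj => x xD.
    by rewrite mnP//= mxP.
  have M1 k : (size (words (common_digits g g') k) <= p ^ K * p ^ s k)%N.
    rewrite size_words -sE; apply: leq_trans (leq_mul (wK k) (leqnn _)).
    by rewrite -big_split; apply: leq_prod => j _; exact: (sz j).1.
  have M2 k : (p ^ s k <= p ^ K * size (words (common_digits g g') k))%N.
    rewrite size_words -sE; apply: leq_trans (leq_mul (wK k) (leqnn _)).
    by rewrite -big_split; apply: leq_prod => j _; exact: (sz j).2.
  have p1 : 1 <= p%:R :> R by rewrite ler1n.
  have pK0 : 0 < p%:R ^+ K :> R by rewrite exprn_gt0 ?ltr0n.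
  have tauX k : (rho `^ lam) ^+ k = p%:R `^ (theta * k%:R).
    by rewrite tauE powRrM powR_mulrn ?powR_ge0.
  (* In the lower constant, [K] factors [p] pay for the initial positions and one more for rounding
     [theta * k] down to [s k]. *)
  apply: (@dim_code _ lam (p%:R ^+ K.+1)^-1 (p%:R ^+ K)).
  - by move=> j; have /andP[] := common_digits_size j gD g'D.
  - by move=> j; rewrite filter_uniq ?dseq_uniq.
  - exact: common_digits_adm.
  - exact: lam0.
  - by rewrite invr_gt0 exprn_gt0 ?ltr0n.
  - move=> k; rewrite tauX mulrC ler_pdivrMr ?exprn_gt0 ?ltr0n//.
    apply: (@le_trans _ _ (p%:R `^ (s k).+1%:R)).
      by apply: ler_powR => //; exact/ltW/truncnS_gt.
    rewrite powR_mulrn ?ler0n// !exprS mulrCA ler_pM2l ?ltr0n//.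
    by rewrite -!natrX -natrM ler_nat mulnC.
  - move=> k; rewrite tauX; apply: (@le_trans _ _ (p%:R ^+ K * p%:R `^ (s k)%:R)).
      by rewrite powR_mulrn ?ler0n// -!natrX -natrM ler_nat.
    rewrite ler_pM2l//; apply: ler_powR => //.
    by rewrite truncn_le mulr_ge0.
have FE := CalphaE gD g'D.
split; rewrite ?FE//.
  by rewrite /FnD /= FE; exists (code g); exists g => //; exact: common_digits_self.
rewrite aE cdistE opprB [code g' - _]addrC addrACA [- code d' + _]addrC.
have mk (x y : nat -> nat) : (forall j, (j < K)%N -> x j = y j) -> mkseq x K = mkseq y K.
  by move=> h; apply/eq_in_map => j; rewrite mem_iota => /andP[_ /h].
have n1 : cdist (code d) (code g) <= A * rho ^- K.
  by apply: code_near => //; apply: mk => j jK; rewrite /g jK.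
have n2' : cdist (code d') (code g') <= A * rho ^- K.
  by apply: code_near => //; apply: mk => j jK; rewrite /g' jK.
apply: le_lt_trans hK; rewrite -mulrA mulr2n mulrDl mul1r.
apply: le_trans (lerD n1 n2'); rewrite !cdistE.
rewrite [normc (code d' - _)]normcB.
exact: normcD.
Qed.

End Expansions.

Theorem theorem4p14 (R : realType) (n : nat) (D : set nat) :
  (2 <= n)%N ->
  D `<=` [set k | (k <= n ^ 2)%N] ->
  ((D `<=` [set k | (k <= (n ^ 2)./2)%N] /\
     (forall d d', diffset D d -> diffset D d' -> `|d - d'| != 1))
   \/ sparse n (diffset D)) ->
  (forall lambda : \bar R, (0 <= lambda)%E -> (lambda <= dimH (CnD R n D))%E ->
     dense_in [set alpha | FnD R n D alpha /\ dimH (Calpha R n D alpha) = lambda]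
              (FnD R n D)) /\
  (forall lambda : \bar R, (0 <= lambda)%E -> (lambda <= dimP (CnD R n D))%E ->
     dense_in [set alpha | FnD R n D alpha /\ dimP (Calpha R n D alpha) = lambda]
              (FnD R n D)).
Proof.
move=> n2 Dn Dgap.
(* Density only concerns given points of [FnD], and any such point provides a digit, so [D] may be
   taken nonempty. *)
have p0 a : FnD R n D a -> (0 < size (dseq n D))%N.
  move=> [z [[d [dD _]] _]]; have := (mem_dseq Dn (d 0%N)).2 (dD 0%N).
  by case: dseq.
split=> lambda l0 lM a Fa e e0; have [dH dP] := dim_CnD R n2 Dn Dgap (p0 a Fa).
- move: lM l0; rewrite dH; case: lambda => [l| |] //; rewrite !lee_fin => lM l0.
  have [|alpha [Fal aH _ ae]] := level_point n2 Dn Dgap (lam := l) _ Fa e0.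
    by rewrite l0.
  by exists alpha.
- move: lM l0; rewrite dP; case: lambda => [l| |] //; rewrite !lee_fin => lM l0.
  have [|alpha [Fal _ aP ae]] := level_point n2 Dn Dgap (lam := l) _ Fa e0.
    by rewrite l0.
  by exists alpha.
Qed.
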